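(* Let $f:X\longrightarrow Y$ be a weak S-homotopy equivalence of flows. Then $H_n^+(f):H_n^+(X)\longrightarrow H_n^+(Y)$ is an isomorphism for every $n\geq 0$.
   Context: $\mathbf{Top}$ is the category of compactly generated topological spaces (weak Hausdorff $k$-spaces). A flow $X$ consists of a compactly generated space $\mathbb{P}X$ (the path space), a discrete space $X^0$ (the set of states), continuous maps $s,t:\mathbb{P}X\to X^0$, and a continuous associative map $*:\{(x,y)\in\mathbb{P}X\times\mathbb{P}X;\ t(x)=s(y)\}\to\mathbb{P}X$ with $s(x*y)=s(x)$ and $t(x*y)=t(y)$. A morphism of flows $f:X\to Y$ consists of a set map $f^0:X^0\to Y^0$ and a continuous map $\mathbb{P}f:\mathbb{P}X\to\mathbb{P}Y$ compatible with $s$, $t$ and $*$. The category of flows is $\mathbf{Flow}$. It carries a unique model structure such that: the weak equivalences are the weak S-homotopy equivalences, i.e. the morphisms $f$ with $f^0$ a bijection and $\mathbb{P}f$ a weak homotopy equivalence; the fibrations are the morphisms $f$ with $\mathbb{P}f$ a Serre fibration. (This model structure may be taken as known.) $Q$ denotes its cofibrant replacement functor: $\varnothing\to X$ factors functorially as a cofibration $\varnothing\to Q(X)$ followed by a trivial fibration $Q(X)\to X$; the latter is a bijection on states, so $Q(X)^0$ is identified with $X^0$. The merging space $\mathbb{P}^+X$ of a flow $X$ is the compactly generated space equipped with a continuous map $h^+:\mathbb{P}X\to\mathbb{P}^+X$ universal among continuous maps $\phi$ from $\mathbb{P}X$ to compactly generated spaces with $\phi(y)=\phi(x*y)$ whenever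 $t(x)=s(y)$. The homotopy merging space is $\mathrm{ho}\mathbb{P}^+X:=\mathbb{P}^+Q(X)$. The target map induces a map $t:\mathrm{ho}\mathbb{P}^+X\to X^0$. Merging homology: let $\mathcal{N}^+_*(X)$ be the augmented simplicial set with $\mathcal{N}^+_n(X)=\mathrm{Sing}_n(\mathrm{ho}\mathbb{P}^+X)$ for $n\geq 0$, $\mathcal{N}^+_{-1}(X)=X^0$, and augmentation $\epsilon:\mathrm{Sing}_0(\mathrm{ho}\mathbb{P}^+X)\to X^0$ induced by $\gamma\mapsto t(\gamma)$. Then $H^+_{n+1}(X)$ is the $n$-th homology group of $\mathcal{N}^+_*(X)$ (integer coefficients) for $n\geq -1$; that is, $H^+_{n+1}(X)=H_n(\mathrm{ho}\mathbb{P}^+X)$ for $n\geq 1$, $H^+_1(X)=\ker(\epsilon)/\operatorname{im}(\partial:\mathbb{Z}\mathcal{N}^+_1(X)\to\mathbb{Z}\mathcal{N}^+_0(X))$ and $H_0^+(X)=\mathbb{Z}(X^0)/\operatorname{im}(\epsilon)$, where $\epsilon$ is extended linearly. *)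

(* Defs.v *)
From HB Require Import structures.
From mathcomp Require Import all_boot all_order all_algebra.
From mathcomp Require Import generic_quotient ring_quotient freeg.
From mathcomp Require Import all_classical all_reals topology normedtype.

Set Implicit Arguments.
Unset Strict Implicit.
Unset Printing Implicit Defensive.

Import Order.TTheory GRing.Theory Num.Theory numFieldNormedType.Exports.

Local Open Scope classical_set_scope.
Local Open Scope ring_scope.

Definition compact_hausdorff (K : topologicalType) : Prop :=
  compact [set: K] /\ hausdorff_space K.

Definition weak_hausdorff (T : topologicalType) : Prop :=
  forall (K : topologicalType) (u : K -> T),
    compact_hausdorff K -> continuous u -> closed (range u).

Definition kopen (T : topologicalType) : set_system T :=
  [set A | forall (K : topologicalType) (u : K -> T),
    compact_hausdorff K -> continuous u -> open (u @^-1` A)].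

Definition k_space (T : topologicalType) : Prop := @kopen T `<=` open.

Definition compactly_generated (T : topologicalType) : Prop :=
  weak_hausdorff T /\ k_space T.

Definition kification (T : Type) : Type := T.

Section Kification.
Variable T : topologicalType.

Let kopenT : kopen [set: T].
Proof. by move=> K u _ _; rewrite preimage_setT; exact: openT. Qed.

Let kopenI : setI_closed (@kopen T).
Proof.
move=> A B oA oB K u hK cu; rewrite preimage_setI.
by apply: openI; [exact: oA | exact: oB].
Qed.

Let kopen_bigU (I : Type) (F : I -> set T) :
  (forall i, kopen (F i)) -> kopen (\bigcup_i F i).
Proof.
move=> oF K u hK cu; rewrite preimage_bigcup.
by apply: bigcup_open => i _; exact: oF.
Qed.

HB.instance Definition _ := Choice.copy (kification T) T.
HB.instance Definition _ :=
  isOpenTopological.Build (kification T) kopenT kopenI kopen_bigU.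
End Kification.

Lemma discrete_compactly_generated (T : discreteTopologicalType) :
  compactly_generated T.
Proof. by split=> [K u _ _|A _]; [exact: discrete_closed|exact: discrete_open]. Qed.

(* The pullback P x_{X^0} P in compactly generated spaces is the
   k-ification of this subspace of the ordinary product (k-ifying the product
   beforehand does not change the result). *)
Definition composable (P : topologicalType) (S : Type) (s t : P -> S) :
  set (P * P) := [set p | t p.1 = s p.2].

Lemma composableP (P : topologicalType) (S : Type) (s t : P -> S)
  (p : composable s t) : t (\val p).1 = s (\val p).2.
Proof. exact: set_mem (valP p). Qed.

Record flow := Flow {
  states : discreteTopologicalType;
  path : topologicalType;
  path_cg : compactly_generated path;
  src : continuousType path states;
  tgt : continuousType path states;
  comp : forall x y : path, tgt x = src y -> path;
  comp_continuous : continuous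
    ((fun p => comp (composableP p)) :
       kification (composable src tgt) -> path);
  src_comp : forall x y (h : tgt x = src y), src (comp h) = src x;
  tgt_comp : forall x y (h : tgt x = src y), tgt (comp h) = tgt y;
  compA : forall x y z (hxy : tgt x = src y) (hyz : tgt y = src z)
    (hl : tgt (comp hxy) = src z) (hr : tgt x = src (comp hyz)),
    comp hl = comp hr
}.

Arguments src {f}.
Arguments tgt {f}.

Record flow_hom (X Y : flow) := FlowHom {
  hom_states : states X -> states Y;
  hom_path : continuousType (path X) (path Y);
  hom_src : forall x, src (hom_path x) = hom_states (src x);
  hom_tgt : forall x, tgt (hom_path x) = hom_states (tgt x);
  hom_comp : forall x y (h : tgt x = src y)
    (h' : tgt (hom_path x) = src (hom_path y)),
    hom_path (comp h) = comp h'
}.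

Definition flow_id (X : flow) : flow_hom X X.
Proof.
refine (@FlowHom X X idfun idfun _ _ _) => //= x y h h'.
by congr comp; exact: Prop_irrelevance.
Defined.

Definition flow_comp (X Y Z : flow) (g : flow_hom Y Z) (f : flow_hom X Y) :
  flow_hom X Z.
Proof.
refine (@FlowHom X Z (hom_states g \o hom_states f)
                     (hom_path g \o hom_path f) _ _ _) => [x|x|x y h h'] /=.
- by rewrite !hom_src.
- by rewrite !hom_tgt.
- have hf : tgt (hom_path f x) = src (hom_path f y) by rewrite hom_tgt h hom_src.
  by rewrite (hom_comp h hf); exact: hom_comp.
Defined.

Section EmptyFlow.
Let E : discreteTopologicalType := discrete_topology void.

Definition empty_flow : flow.
Proof.
by refine (@Flow E E (discrete_compactly_generated E) idfun idfun
  (fun x _ _ => x) _ _ _ _) => // -[[[]]].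
Defined.

Let of_void (T : topologicalType) (x : E) : T := match (x : void) with end.

Let of_void_continuous (T : topologicalType) : continuous (@of_void T).
Proof. by case. Qed.

Definition from_empty (X : flow) : flow_hom empty_flow X.
Proof.
by refine (@FlowHom empty_flow X (@of_void (states X))
  (mkcts (@of_void_continuous (path X))) _ _ _) => -[].
Defined.
End EmptyFlow.

(* The quotient of T by an equivalence relation E, as a set of classes, and
   the map induced on quotients by a compatible map f (all the classes E' (f a)
   for a in C are then the same). *)
Definition classes (T : Type) (E : T -> set T) : set (set T) := range E.

Definition classes_map (T U : Type) (E' : U -> set U) (f : T -> U)
  (C : set T) : set U := \bigcup_(a in C) E' (f a).

Section Homotopy.
Variable R : realType.

Definition unit_interval : set R := `[0, 1].

Definition cube (n : nat) : set 'rV[R]_n :=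
  [set x | forall j, 0 <= x ord0 j <= 1].
Arguments cube n : clear implicits.

Definition cube_boundary (n : nat) : set 'rV[R]_n :=
  [set x | cube n x /\ exists j, x ord0 j = 0 \/ x ord0 j = 1].

Definition path_joined (T : topologicalType) (x : T) : set T :=
  [set y | exists g : continuousType unit_interval T,
    forall r : unit_interval,
      (\val r = 0 -> g r = x) /\ (\val r = 1 -> g r = y)].

Definition pi0 (T : topologicalType) : set (set T) := classes (@path_joined T).
Arguments pi0 T : clear implicits.

(* Maps (I^n, boundary) -> (T, x). *)
Record sphere_map (T : topologicalType) (n : nat) (x : T) := SphereMap {
  sphere_fun :> continuousType (cube n) T;
  sphere_boundary : forall c : cube n, cube_boundary (\val c) -> sphere_fun c = x
}.

Definition homotopic (T : topologicalType) (n : nat) (x : T)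
  (a : sphere_map n x) : set (sphere_map n x) :=
  [set b | exists H : continuousType (cube n * unit_interval)%type T,
    forall (c : cube n) (r : unit_interval),
      [/\ \val r = 0 -> H (c, r) = a c,
          \val r = 1 -> H (c, r) = b c &
          cube_boundary (\val c) -> H (c, r) = x]].

Definition pi_n (T : topologicalType) (n : nat) (x : T) :
  set (set (sphere_map n x)) := classes (@homotopic T n x).
Arguments pi_n {T} n x.

Definition sphere_map_comp (T U : topologicalType) (f : continuousType T U)
  (n : nat) (x : T) (a : sphere_map n x) : sphere_map n (f x) :=
  @SphereMap U n (f x) (f \o a)
    (fun c hc => congr1 f (sphere_boundary a hc)).

Definition weak_homotopy_equivalence (T U : topologicalType)
  (f : continuousType T U) : Prop :=
  set_bij (pi0 T) (pi0 U) (classes_map (@path_joined U) f) /\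
  forall (n : nat) (x : T), (0 < n)%N ->
    set_bij (pi_n n x) (pi_n n (f x))
      (classes_map (@homotopic U n (f x)) (@sphere_map_comp T U f n x)).

(* Homotopy lifting property with respect to all cubes I^n, n >= 0. *)
Definition serre_fibration (E B : topologicalType)
  (p : continuousType E B) : Prop :=
  forall (n : nat) (g : continuousType (cube n) E)
    (H : continuousType (cube n * unit_interval)%type B),
    (forall c (r : unit_interval), \val r = 0 -> H (c, r) = p (g c)) ->
    exists2 G : continuousType (cube n * unit_interval)%type E,
      forall c (r : unit_interval), \val r = 0 -> G (c, r) = g c &
      forall z, p (G z) = H z.

End Homotopy.

Definition flow_class := forall X Y : flow, flow_hom X Y -> Prop.

Definition has_lifting (A B X Y : flow) (i : flow_hom A B) (p : flow_hom X Y) :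
  Prop :=
  forall (u : flow_hom A X) (v : flow_hom B Y), flow_comp p u = flow_comp v i ->
    exists2 l : flow_hom B X, flow_comp l i = u & flow_comp p l = v.

Definition is_retract (A B X Y : flow) (f : flow_hom A B) (g : flow_hom X Y) :
  Prop :=
  exists (iA : flow_hom A X) (rA : flow_hom X A)
         (iB : flow_hom B Y) (rB : flow_hom Y B),
    [/\ flow_comp rA iA = flow_id A, flow_comp rB iB = flow_id B,
        flow_comp g iA = flow_comp iB f & flow_comp f rA = flow_comp rB g].

Definition closed_under_retracts (C : flow_class) : Prop :=
  forall A B X Y (f : flow_hom A B) (g : flow_hom X Y),
    is_retract f g -> C X Y g -> C A B f.

Definition two_out_of_three (W : flow_class) : Prop :=
  forall X Y Z (f : flow_hom X Y) (g : flow_hom Y Z),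
    [/\ W _ _ f -> W _ _ g -> W _ _ (flow_comp g f),
        W _ _ f -> W _ _ (flow_comp g f) -> W _ _ g &
        W _ _ g -> W _ _ (flow_comp g f) -> W _ _ f].

Record model_structure (W Cof Fib : flow_class) : Prop := ModelStructure {
  model_2of3 : two_out_of_three W;
  model_retract_weq : closed_under_retracts W;
  model_retract_cof : closed_under_retracts Cof;
  model_retract_fib : closed_under_retracts Fib;
  model_lift_cof : forall A B X Y (i : flow_hom A B) (p : flow_hom X Y),
    Cof _ _ i -> Fib _ _ p -> W _ _ p -> has_lifting i p;
  model_lift_fib : forall A B X Y (i : flow_hom A B) (p : flow_hom X Y),
    Cof _ _ i -> W _ _ i -> Fib _ _ p -> has_lifting i p;
  model_factor_cof : forall X Y (f : flow_hom X Y),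
    exists (Z : flow) (i : flow_hom X Z) (p : flow_hom Z Y),
      [/\ f = flow_comp p i, Cof _ _ i, Fib _ _ p & W _ _ p];
  model_factor_fib : forall X Y (f : flow_hom X Y),
    exists (Z : flow) (i : flow_hom X Z) (p : flow_hom Z Y),
      [/\ f = flow_comp p i, Cof _ _ i, W _ _ i & Fib _ _ p]
}.

Record cofibrant_replacement (W Cof Fib : flow_class) := CofibrantReplacement {
  cr_obj :> flow -> flow;
  cr_map : forall X Y, flow_hom X Y -> flow_hom (cr_obj X) (cr_obj Y);
  cr_map_id : forall X, cr_map (flow_id X) = flow_id (cr_obj X);
  cr_map_comp : forall X Y Z (g : flow_hom Y Z) (f : flow_hom X Y),
    cr_map (flow_comp g f) = flow_comp (cr_map g) (cr_map f);
  cr_proj : forall X, flow_hom (cr_obj X) X;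
  cr_natural : forall X Y (f : flow_hom X Y),
    flow_comp (cr_proj Y) (cr_map f) = flow_comp f (cr_proj X);
  cr_cofibrant : forall X, Cof _ _ (from_empty (cr_obj X));
  cr_fibration : forall X, Fib _ _ (cr_proj X);
  cr_weq : forall X, W _ _ (cr_proj X)
}.

Definition weak_S_homotopy_equivalence (R : realType) : flow_class :=
  fun X Y f => bijective (hom_states f) /\
               weak_homotopy_equivalence R (hom_path f).

Definition flow_fibration (R : realType) : flow_class :=
  fun X Y f => serre_fibration R (hom_path f).

Definition merging_invariant (X : flow) (T : Type) (phi : path X -> T) : Prop :=
  forall x y (h : tgt x = src y), phi y = phi (comp h).

Record merging_space (X : flow) := MergingSpace {
  mg_space :> topologicalType;
  mg_cg : compactly_generated mg_space;
  mg_proj : continuousType (path X) mg_space;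
  mg_invariant : merging_invariant mg_proj;
  mg_universal : forall (T : topologicalType) (phi : continuousType (path X) T),
    compactly_generated T -> merging_invariant phi ->
    exists! psi : continuousType mg_space T, forall x, psi (mg_proj x) = phi x
}.

Arguments mg_proj {X} m.
Arguments mg_invariant {X} m [x y] h.
Arguments mg_universal {X m} [T phi].

Section MergingMap.
Variables (X : flow) (M : merging_space X).

Section Lift.
Variables (T : topologicalType) (phi : continuousType (path X) T).
Hypotheses (cgT : compactly_generated T) (inv : merging_invariant phi).

Definition merging_lift : continuousType M T :=
  sval (cid (mg_universal cgT inv)).

Lemma merging_liftE x : merging_lift (mg_proj M x) = phi x.
Proof. by rewrite /merging_lift; case: cid => psi [h _] /=; exact: h. Qed.
End Lift.

Lemma merging_ext (T : topologicalType) (psi psi' : continuousType M T) :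
  compactly_generated T ->
  (forall x, psi (mg_proj M x) = psi' (mg_proj M x)) -> psi = psi'.
Proof.
move=> cgT h.
pose phi : continuousType (path X) T := psi \o mg_proj M.
have inv : merging_invariant phi.
  by move=> x y e; rewrite /phi /= (mg_invariant M e).
have [psi0 [_ u]] := @mg_universal X M T phi cgT inv.
rewrite -(u psi (fun=> erefl)); apply: u => x; exact: esym (h x).
Qed.

Lemma merging_invariant_hom (Y : flow) (N : merging_space Y)
  (f : flow_hom X Y) :
  merging_invariant (mg_proj N \o hom_path f : continuousType (path X) N).
Proof.
move=> x y h /=.
have h' : tgt (hom_path f x) = src (hom_path f y) by rewrite hom_tgt h hom_src.
by rewrite (hom_comp h h') (mg_invariant N h').
Qed.

Definition merging_map (Y : flow) (N : merging_space Y) (f : flow_hom X Y) :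
  continuousType M N :=
  merging_lift (mg_cg N) (merging_invariant_hom N f).

Lemma merging_invariant_tgt (Y : flow) (f : flow_hom X Y) :
  merging_invariant (tgt \o hom_path f : continuousType (path X) (states Y)).
Proof. by move=> x y h /=; rewrite !hom_tgt tgt_comp. Qed.

Definition merging_tgt (Y : flow) (f : flow_hom X Y) :
  continuousType M (states Y) :=
  merging_lift (@discrete_compactly_generated (states Y)) (merging_invariant_tgt f).

End MergingMap.

Section Homology.
Variables (A B C : zmodType) (d1 : {additive A -> B}) (d0 : {additive B -> C}).

Definition cycles : pred B := fun b => d0 b == 0.

Fact cycles_zmod_closed : zmod_closed cycles.
Proof.
split=> [|x y]; rewrite !unfold_in /cycles ?raddf0 // => /eqP hx /eqP hy.
by rewrite raddfB hx hy subrr.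
Qed.
HB.instance Definition _ := GRing.isZmodClosed.Build B cycles cycles_zmod_closed.

Record cycle := Cycle { cycle_val : B; cycleP : cycle_val \in cycles }.
HB.instance Definition _ := [isSub for cycle_val].
HB.instance Definition _ := [Choice of cycle by <:].
HB.instance Definition _ := [SubChoice_isSubZmodule of cycle by <:].

(* The image of d1 is taken inside ker d0, so d0 \o d1 = 0 is not needed to
   form the quotient ker d0 / im d1 below. *)
Definition boundaries : pred cycle := fun z => `[< exists a, d1 a = \val z >].

Fact boundaries_zmod_closed : zmod_closed boundaries.
Proof.
split=> [|x y].
  by apply/asboolP; exists 0; rewrite !raddf0.
move=> /asboolP[a ha] /asboolP[b hb]; apply/asboolP; exists (a - b).
by rewrite !raddfB ha hb.
Qed.
HB.instance Definition _ :=
  GRing.isZmodClosed.Build cycle boundaries boundaries_zmod_closed.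

Definition homology : zmodType :=
  Quotient.quot (GRing.ZmodClosed.clone cycle boundaries _).

Definition homology_class (z : cycle) : homology :=
  (\pi_(Quotient.quot (GRing.ZmodClosed.clone cycle boundaries _)) z)%qT.

Definition homology_repr (h : homology) : cycle := (repr h)%qT.

Lemma homology_reprK : cancel homology_repr homology_class.
Proof. by move=> h; exact: reprK. Qed.

Lemma homology_classP (x y : cycle) :
  homology_class x = homology_class y <-> exists a, d1 a = \val (x - y).
Proof.
split=> [/eqP|h]; last apply/eqP;
  rewrite /homology_class -Quotient.idealrBE; first by move/asboolP.
exact/asboolP.
Qed.

Fact homology_class_zmod_morphism : zmod_morphism homology_class.
Proof. by move=> x y; rewrite /homology_class raddfB. Qed.
HB.instance Definition _ :=
  GRing.isZmodMorphism.Build cycle homology homology_class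
    homology_class_zmod_morphism.
End Homology.

Section HomologyMap.
Variables (A B C A' B' C' : zmodType).
Variables (d1 : {additive A -> B}) (d0 : {additive B -> C}).
Variables (d1' : {additive A' -> B'}) (d0' : {additive B' -> C'}).
Variables (fA : {additive A -> A'}) (fB : {additive B -> B'}).
Variables (fC : {additive C -> C'}).
Hypothesis f_d : (forall a, fB (d1 a) = d1' (fA a)) /\
                 (forall b, fC (d0 b) = d0' (fB b)).

Fact cycle_map_subproof (z : cycle d0) : fB (\val z) \in cycles d0'.
Proof. by rewrite unfold_in /cycles -f_d.2 (eqP (cycleP z)) raddf0. Qed.

Definition cycle_map (z : cycle d0) : cycle d0' := Cycle (cycle_map_subproof z).

Definition homology_map (h : homology d1 d0) : homology d1' d0' :=
  homology_class d1' (cycle_map (homology_repr h)).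

Lemma homology_mapE (z : cycle d0) :
  homology_map (homology_class d1 z) = homology_class d1' (cycle_map z).
Proof.
apply/homology_classP.
have /homology_classP[a ha] := homology_reprK (homology_class d1 z).
by exists (fA a); rewrite -f_d.1 ha !raddfB.
Qed.

Fact homology_map_zmod_morphism : zmod_morphism homology_map.
Proof.
move=> x y; rewrite -[x]homology_reprK -[y]homology_reprK -raddfB.
rewrite !homology_mapE -raddfB; congr homology_class.
by apply: val_inj; rewrite /= !raddfB.
Qed.
HB.instance Definition _ :=
  GRing.isZmodMorphism.Build (homology d1 d0) (homology d1' d0') homology_map
    homology_map_zmod_morphism.
End HomologyMap.

(* Only the face maps of an augmented simplicial set enter its homology.
   Dimensions are shifted by one: [simplices k] is the set of simplices of
   dimension k - 1, so that [face] on [simplices 1] is the augmentation. *)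
Record augmented_faces := AugmentedFaces {
  simplices :> nat -> choiceType;
  face : forall k, 'I_k.+1 -> simplices k.+1 -> simplices k
}.

Section FreeLift.
Variables (K L : choiceType) (f : K -> {freeg L / int}).

Definition free_lift : {freeg K / int} -> {freeg L / int} := fglift f.

Fact free_lift_zmod_morphism : zmod_morphism free_lift.
Proof. exact: lift_is_additive. Qed.
HB.instance Definition _ :=
  GRing.isZmodMorphism.Build {freeg K / int} {freeg L / int} free_lift
    free_lift_zmod_morphism.

Lemma free_liftU x : free_lift << x >> = f x.
Proof. by rewrite /free_lift liftU scale1r. Qed.
End FreeLift.

Lemma free_lift_ext (K : choiceType) (M : zmodType)
  (g h : {additive {freeg K / int} -> M}) :
  (forall x, g << x >> = h << x >>) -> g =1 h.
Proof.
move=> gh c; rewrite -[c]freeg_sumE !raddf_sum; apply: eq_bigr => x _.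
by rewrite -[coeff x c]intz -freegU_mulz !raddfMz gh.
Qed.

Section AugmentedChains.
Variable N : augmented_faces.

Definition boundary (k : nat) :
  {additive {freeg (N k.+1) / int} -> {freeg (N k) / int}} :=
  free_lift (fun x => \sum_(i < k.+1) << (-1) ^+ i *g face i x >>).

Definition boundary_out (k : nat) :
  {additive {freeg (N k) / int} -> {freeg (N k.-1) / int}} :=
  match k with
  | 0 => \0
  | j.+1 => boundary j
  end.

Definition augmented_homology (k : nat) : zmodType :=
  homology (boundary k) (boundary_out k).

End AugmentedChains.

Section AugmentedChainsMap.
Variables (N N' : augmented_faces) (f : forall k, N k -> N' k).
Hypothesis f_face : forall k (i : 'I_k.+1) x, f (face i x) = face i (f x).

Definition chain_map (k : nat) :
  {additive {freeg (N k) / int} -> {freeg (N' k) / int}} :=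
  free_lift (fun x => << f x >>).

Lemma chain_map_boundary k c :
  chain_map k (boundary N k c) = boundary N' k (chain_map k.+1 c).
Proof.
apply: (free_lift_ext (g := chain_map k \o boundary N k)
                      (h := boundary N' k \o chain_map k.+1)) => x /=.
rewrite !free_liftU raddf_sum; apply: eq_bigr => i _.
have E (K : choiceType) (x0 : K) :
  << (-1) ^+ i *g x0 >> = << x0 >> *~ ((-1) ^+ i) :> {freeg K / int}.
  by rewrite freegU_mulz intz.
by rewrite !E raddfMz /= free_liftU f_face.
Qed.

Lemma chain_map_boundary_out k c :
  chain_map k.-1 (boundary_out N k c) = boundary_out N' k (chain_map k c).
Proof. by case: k c => [c|k c]; [rewrite raddf0 | exact: chain_map_boundary]. Qed.

Definition augmented_homology_map (k : nat) :
  {additive augmented_homology N k -> augmented_homology N' k} :=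
  homology_map (conj (@chain_map_boundary k) (@chain_map_boundary_out k)).

End AugmentedChainsMap.

Section Simplex.
Variable R : realType.

Definition simplex (n : nat) : set 'rV[R]_n.+1 :=
  [set x | (forall j, 0 <= x ord0 j) /\ \sum_j x ord0 j = 1].
Arguments simplex n : clear implicits.

Definition insert_zero (n : nat) (i : 'I_n.+2) (x : 'rV[R]_n.+1) :
  'rV[R]_n.+2 := \row_j oapp (x ord0) 0 (unlift i j).

Lemma insert_zero_simplex n (i : 'I_n.+2) (x : simplex n) :
  insert_zero i (\val x) \in simplex n.+1.
Proof.
have [x0 x1] := set_mem (valP x); apply/mem_set; split=> [j|].
  by rewrite mxE; case: unlift => /=.
rewrite (bigD1_ord i) //= mxE unlift_none /= add0r -[RHS]x1.
by apply: eq_bigr => j _; rewrite mxE liftK.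
Qed.

Definition coface n (i : 'I_n.+2) (x : simplex n) : simplex n.+1 :=
  exist _ (insert_zero i (\val x)) (insert_zero_simplex i x).

Lemma coface_continuous n (i : 'I_n.+2) : continuous (@coface n i).
Proof.
have cv : continuous (fun x : simplex n => insert_zero i (\val x)).
  move=> x; have /(_ x) cval := @initial_continuous (simplex n) _ set_val.
  rewrite set_valE in cval; apply: (continuous_comp cval) => {cval} A [P hP sPA].
  exists (fun _ k => P ord0 (fintype.lift i k)) => [j k|y hy].
    by have := hP ord0 (fintype.lift i k); rewrite mxE liftK /= (ord1 j).
  apply: sPA => j k; rewrite ord1 mxE; case: unliftP => [l ->|->] /=.
    exact: hy.
  by have := nbhs_singleton (hP ord0 i); rewrite mxE unlift_none.
apply/continuousP => A [B oB <-].
by have /continuousP/(_ B oB) := cv.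
Qed.

Definition singular_simplices (T : topologicalType) (n : nat) : choiceType :=
  continuousType (simplex n) T.

Definition singular_face (T : topologicalType) (n : nat) (i : 'I_n.+2)
  (sigma : singular_simplices T n.+1) : singular_simplices T n :=
  sigma \o mkcts (@coface_continuous n i).

Fact simplex_point_subproof : const_mx 1 \in simplex 0.
Proof.
apply/mem_set; split=> [j|]; first by rewrite mxE.
by rewrite big_ord1 mxE.
Qed.

Definition simplex_point : simplex 0 := exist _ (const_mx 1) simplex_point_subproof.

End Simplex.

Section MergingHomology.
Variables (R : realType) (W Cof Fib : flow_class).
Variables (Q : cofibrant_replacement W Cof Fib).
Variable M : forall X : flow, merging_space X.

Definition ho_merging (X : flow) : topologicalType := M (Q X).

Definition ho_merging_map (X Y : flow) (f : flow_hom X Y) :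
  continuousType (ho_merging X) (ho_merging Y) :=
  merging_map (M (Q X)) (M (Q Y)) (cr_map Q f).

(* The class of gamma : path (Q X) goes to the target of its image in X; this
   is how the target in states (Q X) is seen as an element of states X. *)
Definition ho_merging_tgt (X : flow) :
  continuousType (ho_merging X) (states X) :=
  merging_tgt (M (Q X)) (cr_proj Q X).

Definition merging_nerve (X : flow) : augmented_faces :=
  @AugmentedFaces
    (fun k => match k with
              | 0 => states X : choiceType
              | n.+1 => singular_simplices R (ho_merging X) n
              end)
    (fun k => match k with
              | 0 => fun _ gamma => ho_merging_tgt X (gamma (simplex_point R))
              | n.+1 => fun i sigma => singular_face i sigma
              end).

Definition merging_nerve_map (X Y : flow) (f : flow_hom X Y) (k : nat) :
  merging_nerve X k -> merging_nerve Y k :=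
  match k with
  | 0 => hom_states f
  | n.+1 => fun sigma => ho_merging_map f \o sigma
  end.

Lemma ho_merging_map_tgt (X Y : flow) (f : flow_hom X Y) z :
  ho_merging_tgt Y (ho_merging_map f z) = hom_states f (ho_merging_tgt X z).
Proof.
have cf : continuous (hom_states f).
  by apply/continuousP => A _; exact: discrete_open.
have := @merging_ext _ (M (Q X)) (states Y)
  (ho_merging_tgt Y \o ho_merging_map f) (mkcts cf \o ho_merging_tgt X)
  (@discrete_compactly_generated (states Y)).
move=> /(_ _) /continuousEP; apply => x.
rewrite /= /ho_merging_map /ho_merging_tgt /merging_map /merging_tgt.
rewrite merging_liftE /= !merging_liftE /= /mkcts -hom_tgt.
by have /(congr1 (fun g => tgt (hom_path g x))) := cr_natural Q f.
Qed.

Lemma merging_nerve_map_face (X Y : flow) (f : flow_hom X Y) k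
    (i : 'I_k.+1) (x : merging_nerve X k.+1) :
  merging_nerve_map f (face i x) = face i (merging_nerve_map f x).
Proof.
case: k i x => [|n] i x /=; first by rewrite ho_merging_map_tgt.
by apply/continuousEP.
Qed.

Definition merging_homology (n : nat) (X : flow) : zmodType :=
  augmented_homology (merging_nerve X) n.

Definition merging_homology_map (n : nat) (X Y : flow) (f : flow_hom X Y) :
  {additive merging_homology n X -> merging_homology n Y} :=
  augmented_homology_map (@merging_nerve_map_face X Y f) n.

End MergingHomology.

Definition group_isomorphism (G H : zmodType) (phi : {additive G -> H}) : Prop :=
  exists psi : {additive H -> G}, cancel phi psi /\ cancel psi phi.

(* Main.v *)
(* [P^+] is left adjoint to the functor sending a space [T] to the flow with one
   state, path space [T] and [x * y = y], which preserves fibrations. All flows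
   being fibrant, a trivial cofibration [j] has a retraction [r]; lifting against
   the image of the path fibration [T^I -> T * T], [T = P^+ B], shows that [j r]
   induces a map homotopic to the identity, so [j] is a homology isomorphism.
   A weak equivalence [Q f] of cofibrant flows factors as [p i], where [i] is a
   trivial cofibration and [p] a trivial fibration with a section [s]. Factoring
   [s = q j] in the same way, [q] has a section too: [s] is then surjective in
   homology because [q] and [j] are, and injective because [p s = 1], hence [s]
   and [p] are isomorphisms. *)
Require Import Defs.
From HB Require Import structures.
From mathcomp Require Import all_boot all_order all_algebra.
From mathcomp Require Import freeg.
From mathcomp Require Import all_classical all_reals topology normedtype.
From mathcomp Require Import ring zify.

Set Implicit Arguments.
Unset Strict Implicit.
Unset Printing Implicit Defensive.

Import Order.TTheory GRing.Theory Num.Theory numFieldNormedType.Exports.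

Local Open Scope classical_set_scope.
Local Open Scope ring_scope.

(** * Compactly generated spaces *)

Section CompactHausdorff.

Lemma continuous_pair (S T U : topologicalType) (f : S -> T) (g : S -> U) :
  continuous f -> continuous g -> continuous (fun x => (f x, g x)).
Proof. by move=> cf cg x; apply: cvg_pair; [exact: cf | exact: cg]. Qed.

Lemma continuous_fst (T U : topologicalType) : continuous (@fst T U).
Proof. by move=> x; exact: cvg_fst. Qed.

Lemma continuous_snd (T U : topologicalType) : continuous (@snd T U).
Proof. by move=> x; exact: cvg_snd. Qed.

Lemma continuous_o (S T U : topologicalType) (g : T -> U) (f : S -> T) :
  continuous g -> continuous f -> continuous (fun x => g (f x)).
Proof. by move=> cg cf x; apply: continuous_comp; [exact: cf | exact: cg]. Qed.

Lemma continuous_set_val (T : topologicalType) (A : set T) :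
  continuous (fun x : A => \val x).
Proof. by move=> x; have := @initial_continuous A _ set_val x. Qed.

Lemma continuous_into_set (S T : topologicalType) (A : set T) (f : S -> A) :
  continuous (fun x => \val (f x)) -> continuous f.
Proof.
by move=> /continuousP cf; apply/continuousP => _ [B oB <-]; exact: (cf _ oB).
Qed.

Lemma compact_set_type (T : topologicalType) (A : set T) :
  compact A -> compact [set: A].
Proof.
move=> cA F PF FT.
have [|p [Ap clp]] := cA (fmap (fun x : A => \val x) F) (fmap_proper_filter _ PF).
  by apply: (@filterS _ F _ setT) FT => x _; exact: set_valP.
exists (exist _ p (mem_set Ap)); split=> // B C FB [_ [[D oD <-] Dp DC]].
have [||y [[x Bx <-] Dy]] := clp (set_val @` B) D _ _.
- by apply: (@filterS _ F _ B) FB => x Bx; exists x.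
- exact: (open_nbhs_nbhs (conj oD Dp)).
- by exists x; split=> //; exact: DC.
Qed.

Lemma hausdorff_inj (S T : topologicalType) (f : S -> T) :
  continuous f -> injective f -> hausdorff_space T -> hausdorff_space S.
Proof.
move=> cf fI hT p q pq; apply: fI; apply: hT => A B nA nB.
by have [x [Ax Bx]] := pq _ _ (cf p _ nA) (cf q _ nB); exists (f x).
Qed.

Lemma compact_hausdorff_set_type (T : topologicalType) (A : set T) :
  hausdorff_space T -> compact A -> compact_hausdorff A.
Proof.
move=> hT cA; split; first exact: compact_set_type.
by apply: hausdorff_inj hT; [exact: continuous_set_val | exact: val_inj].
Qed.

Lemma compact_hausdorff_closed (T : topologicalType) (A : set T) :
  compact_hausdorff T -> closed A -> compact_hausdorff A.
Proof.
move=> [cT hT] clA; apply: compact_hausdorff_set_type => //.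
exact: subclosed_compact clA cT _.
Qed.

Lemma compact_hausdorff_prod (S T : topologicalType) :
  compact_hausdorff S -> compact_hausdorff T -> compact_hausdorff (S * T)%type.
Proof.
move=> [cS hS] [cT hT]; split; first by rewrite -setXTT; exact: compact_setX.
move=> [a b] [c d] h; congr pair; [apply: hS => A B nA nB|apply: hT => A B nA nB].
  have [||x [/= Ax Bx]] := h (fst @^-1` A) (fst @^-1` B) _ _.
  - exact: (@continuous_fst S T (a, b) A nA).
  - exact: (@continuous_fst S T (c, d) B nB).
  - by exists x.1.
have [||x [/= Ax Bx]] := h (snd @^-1` A) (snd @^-1` B) _ _.
- exact: (@continuous_snd S T (a, b) A nA).
- exact: (@continuous_snd S T (c, d) B nB).
- by exists x.2.
Qed.

(* The image of a compact Hausdorff space in a weak Hausdorff space is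
   Hausdorff: [a] is a closed map, so disjoint neighbourhoods of two of its
   fibers push forward to separate the images. *)
Lemma weak_hausdorff_equalizer (R : realType) (K T : topologicalType)
    (a b : K -> T) :
  compact_hausdorff K -> weak_hausdorff T -> continuous a -> continuous b ->
  closed [set z | a z = b z].
Proof.
move=> hK wT ca cb.
have acl (F : set K) : closed F -> closed (a @` F).
  move=> clF; have := wT _ (a \o (fun x : F => \val x)).
  have -> : range (a \o (fun x : F => \val x)) = a @` F.
    apply/seteqP; split=> [_ [x _ <-]|_ [x Fx <-]].
      by exists (\val x) => //; exact: set_mem (valP x).
    by exists (exist _ x (mem_set Fx)).
  by apply; [exact: compact_hausdorff_closed
            |apply: continuous_o => //; exact: continuous_set_val].
(* Points of [T] are closed as images of constant maps; [z] only witnesses that [K] is nonempty. *)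
have ptcl (z : K) (y : T) : closed [set y].
  have -> : [set y] = range (fun _ : K => y).
    by apply/seteqP; split=> [_ ->|_ [? _ <-]] //; exists z.
  by apply: wT => //; exact: cst_continuous.
rewrite -[X in closed X]setCK; apply: open_closedC; rewrite openE => z0 /= ne.
have nK : normal_space K by case: hK => cK hK; exact: compact_normal.
have clf y : closed (a @^-1` [set y]).
  by apply: preimage_closed => [x _|]; [exact: ca | exact: (ptcl z0)].
have [|U1 [U2 [oU1 oU2 s1 s2 U12]]] :=
    (@normal_openP R K).1 nK _ _ (clf (a z0)) (clf (b z0)) _.
  by rewrite -subset0 => z [/= ->].
(* The neighbourhood consists of the [z] whose [a]-fiber over [f z] lies in [U]. With [f = a] and
   [f = b], a nearby [z] such that [a z = b z] would lie in both [U1] and [U2]. The fiber over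
   [b z0] may be empty. *)
have op (f : K -> T) (U : set K) (cf : continuous f) : open U ->
    a @^-1` [set f z0] `<=` U -> nbhs z0 (f @^-1` (~` (a @` (~` U)))).
  move=> oU sU; apply: open_nbhs_nbhs; split.
    move/continuousP: cf; apply; apply: closed_openC; apply: acl.
    exact: open_closedC.
  by move=> /= -[z nU e]; apply: nU; exact: sU.
apply: filterS (filterI (op a U1 ca oU1 s1) (op b U2 cb oU2 s2)).
move=> z [/= h1 h2] e.
suff : (U1 `&` U2) z by rewrite U12.
by split; apply: contrapT => nU; [apply: h1 | apply: h2]; exists z.
Qed.

Lemma open_kificationE (T : topologicalType) (A : set T) :
  open (A : set (kification T)) = kopen A.
Proof. by []. Qed.

Lemma continuous_from_kification (T : topologicalType) :
  continuous (id : kification T -> T).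
Proof.
apply/continuousP => A oA; rewrite open_kificationE => K u _ /continuousP.
exact.
Qed.

(** A test map into [T] pulls [kopen] sets back to open sets, so it is also a test map into
    [kification T]: k-ifying twice changes nothing. *)
Lemma k_space_kification (T : topologicalType) : k_space (kification T).
Proof.
move=> A kA; rewrite open_kificationE => L v hL cv; apply: kA => //.
by apply/continuousP => B; rewrite open_kificationE; exact.
Qed.

(** The preimage under [v] of the range of [u] is the projection of the equalizer of [u] and [v] in
    the compact space [K * L], hence compact and closed. The hypothesis is phrased with equalizers
    because it can be checked coordinatewise for products and path spaces. *)
Lemma compactly_generated_kification (T : topologicalType) :
  (forall (K : topologicalType) (u v : K -> T), compact_hausdorff K ->
    continuous u -> continuous v -> closed [set z | u z = v z]) ->
  compactly_generated (kification T).
Proof.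
move=> eqcl.
have cid := @continuous_from_kification T.
split=> [K u hK cu|]; last exact: k_space_kification.
rewrite -[X in closed X]setCK; apply: open_closedC.
rewrite open_kificationE => L v hL cv.
suff : closed (v @^-1` range u) by move/closed_openC.
have hKL := compact_hausdorff_prod hK hL.
have {}cu : continuous (u : K -> T) by exact: (continuous_o cid cu).
have cl := eqcl _ (fun p : K * L => u p.1) (fun p => v p.2) hKL
  (continuous_o cu (@continuous_fst _ _)) (continuous_o cv (@continuous_snd _ _)).
have -> : v @^-1` range u = snd @` [set p : K * L | u p.1 = v p.2].
  apply/seteqP; split=> [l [k _ e]|_ [[k l] /= e <-]]; first by exists (k, l).
  by exists k.
apply: compact_closed; first by case: hL.
apply: continuous_compact; last by apply: subclosed_compact cl hKL.1 _.
by apply: continuous_subspaceT => x; exact: continuous_snd.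
Qed.

Lemma continuous_into_kification (S T : topologicalType) (f : S -> T) :
  k_space S -> continuous f -> continuous (f : S -> kification T).
Proof.
move=> kS cf; apply/continuousP => A oA; apply: kS => K u hK cu.
exact: (oA K (f \o u) hK (continuous_o cf cu)).
Qed.

Lemma compact_hausdorff_k_space (S : topologicalType) :
  compact_hausdorff S -> k_space S.
Proof. by move=> hS A kA; apply: (kA S id hS) => x. Qed.

Lemma compactly_generated_prod (R : realType) (T : topologicalType) :
  weak_hausdorff T -> compactly_generated (kification (T * T)%type).
Proof.
move=> wT; apply: compactly_generated_kification => K u v hK cu cv.
have -> : [set z | u z = v z] =
    [set z | (u z).1 = (v z).1] `&` [set z | (u z).2 = (v z).2].
  apply/seteqP; split=> z /= => [->|[]] //.
  by case: (u z) (v z) => [? ?] [? ?] /= -> ->.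
by apply: closedI; apply: (weak_hausdorff_equalizer R hK wT);
  apply: continuous_o => //;
  [exact: continuous_fst | exact: continuous_fst
  |exact: continuous_snd | exact: continuous_snd].
Qed.

(** Gluing along the closed cover by [w x <= a] and [a <= w x]. *)
Lemma continuous_if_le (R : realType) (S T : topologicalType) (w : S -> R)
    (a : R) (f g : S -> T) :
  continuous w -> continuous f -> continuous g ->
  (forall x, w x = a -> f x = g x) ->
  continuous (fun x => if w x <= a then f x else g x).
Proof.
move=> cw cf cg fg; apply/continuous_closedP => C clC.
have -> : (fun x => if w x <= a then f x else g x) @^-1` C =
    (w @^-1` [set y | y <= a] `&` f @^-1` C) `|`
    (w @^-1` [set y | a <= y] `&` g @^-1` C).
  apply/seteqP; split=> x /=.
    by case: leP => [le Cx|/ltW le Cx]; [left | right].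
  case=> [[->]|[ge Cx]] //; case: leP => // le.
  by rewrite fg //; apply/eqP; rewrite eq_le le.
have pc (h : S -> T) : continuous h -> closed (h @^-1` C).
  by move=> ch; apply: preimage_closed => // x _; exact: ch.
apply: closedU; (apply: closedI; last exact: pc).
  by apply: preimage_closed => [x _|]; [exact: cw | exact: closed_le].
by apply: preimage_closed => [x _|]; [exact: cw | exact: closed_ge].
Qed.

End CompactHausdorff.

(** * Path spaces and the path fibration *)

Section PathSpace.
Variable R : realType.
Local Notation I := (@unit_interval R).

Lemma unit_interval_compact_hausdorff : compact_hausdorff I.
Proof.
apply: compact_hausdorff_set_type; first exact: Rhausdorff.
exact: segment_compact.
Qed.

Lemma cube_compact_hausdorff n : compact_hausdorff (@cube R n).
Proof.
apply: compact_hausdorff_set_type; first exact: norm_hausdorff.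
have := @rV_compact R n (fun _ => `[0, 1]%classic) (fun _ => @segment_compact R 0 1).
by congr compact; apply/seteqP; split=> v /= + i => /(_ i); rewrite in_itv.
Qed.

Lemma unit_interval_locally_compact : locally_compact [set: I].
Proof.
move=> x _; rewrite withinET; exists setT; first exact: filterT.
by split; [exact: unit_interval_compact_hausdorff.1 | exact: closedT].
Qed.

Import ArrowAsCompactOpen.

(** The compact-open topology is k-ified so that the result can serve as the path space of a
    flow. *)
Definition path_space (T : topologicalType) : topologicalType :=
  kification (continuousType I T).

(** Evaluation is jointly continuous for the compact-open topology because the interval is locally
    compact and regular, and k-ifying only refines the topology of the space of paths. *)
Lemma continuous_path_eval (S T : topologicalType) (u : S -> path_space T) :
  continuous u ->
  continuous (fun p : S * I => (u p.1 : continuousType I T) p.2).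
Proof.
move=> cu.
have cev := @eval_continuous I T unit_interval_locally_compact
  (@uniform_regular _).
apply: (@continuous_o _ _ _ (@eval I T)
  (fun p : S * I => (u p.1 : continuousType I T, p.2)) cev).
apply: continuous_pair; last exact: continuous_snd.
apply: (@continuous_o _ _ _ (id : path_space T -> continuousType I T)
  (fun p : S * I => u p.1)); first exact: continuous_from_kification.
exact: (continuous_o cu (@continuous_fst _ _)).
Qed.

Lemma continuous_path_at (S T : topologicalType) (u : S -> path_space T) (r : I) :
  continuous u -> continuous (fun z => (u z : continuousType I T) r).
Proof.
move=> cu; apply: (continuous_o (continuous_path_eval cu) (f := fun z => (z, r))).
by apply: continuous_pair; [move=> x | exact: cst_continuous].
Qed.

(** Currying is continuous for the compact-open topology; a k-space as source allows the target to
    be k-ified. *)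
Lemma continuous_path_curry (S T : topologicalType) (f : S * I -> T)
    (u : S -> path_space T) :
  k_space S -> continuous f ->
  (forall s r, (u s : continuousType I T) r = f (s, r)) -> continuous u.
Proof.
move=> kS cf uE; apply: (continuous_into_kification kS).
apply/continuousP => _ [B oB <-].
have /continuousP/(_ _ oB) := continuous_curry_fun cf.
by congr open; apply/seteqP; split=> x /=;
  (rewrite (_ : curry f x = u x); last by apply/funext => r; rewrite uE).
Qed.

(** The equalizer of two families of paths is the intersection, over all times [r], of the
    equalizers of their values at [r]. *)
Lemma compactly_generated_path_space (T : topologicalType) :
  weak_hausdorff T -> compactly_generated (path_space T).
Proof.
move=> wT; apply: compactly_generated_kification => K u v hK cu cv.
have cev (w : K -> continuousType I T) (r : I) :
    continuous w -> continuous (fun z => w z r).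
  move=> cw; apply: (@continuous_path_at _ _ (w : K -> path_space T)).
  exact: (continuous_into_kification (compact_hausdorff_k_space hK)).
have -> : [set z | u z = v z] = \bigcap_(r in [set: I]) [set z | u z r = v z r].
  apply/seteqP; split=> z /= => [e r _ /=|h]; first by rewrite e.
  by apply/continuousEP => r; exact: h.
apply: closed_bigI => r _.
by apply: (weak_hausdorff_equalizer R hK wT); exact: cev.
Qed.

(** Retraction of the line onto the unit interval: times can be given by arbitrary real formulas,
    and [clampI 0] and [clampI 1] are the endpoints. *)
Definition clamp (x : R) : R := Num.max 0 (Num.min 1 x).

Fact clampP x : clamp x \in @unit_interval R.
Proof.
apply/mem_set; rewrite /unit_interval /= in_itv /= /clamp.
by rewrite le_max lexx /= ge_max ler01 /= ge_min lexx.
Qed.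

Definition clampI (x : R) : I := exist _ (clamp x) (clampP x).

Lemma continuous_clampI : continuous clampI.
Proof.
apply: continuous_into_set => x /=.
apply: continuous_max; first exact: cvg_cst.
by apply: continuous_min; [exact: cvg_cst | ].
Qed.

Lemma clamp_id (x : R) : 0 <= x <= 1 -> clamp x = x.
Proof. by move=> /andP[r0 r1]; rewrite /clamp min_r // max_r. Qed.

Lemma clamp0 : clamp 0 = 0. Proof. by rewrite clamp_id // lexx ler01. Qed.

Lemma clamp1 : clamp 1 = 1. Proof. by rewrite clamp_id // lexx ler01. Qed.

Lemma clampIK (r : I) : clampI (\val r) = r.
Proof.
apply: val_inj; apply: clamp_id.
by have := set_valP r; rewrite /unit_interval /= in_itv.
Qed.

Definition path_ends_fun (T : topologicalType) (g : path_space T) :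
  kification (T * T)%type :=
  ((g : continuousType I T) (clampI 0), (g : continuousType I T) (clampI 1)).

Lemma path_ends_continuous (T : topologicalType) :
  continuous (@path_ends_fun T).
Proof.
apply: (continuous_into_kification (@k_space_kification _)).
by apply: continuous_pair; apply: (@continuous_path_at _ _ id) => x.
Qed.

Definition path_ends (T : topologicalType) :
  continuousType (path_space T) (kification (T * T)%type) :=
  mkcts (@path_ends_continuous T).

Definition constant_path_fun (T : topologicalType) (x : T) : path_space T :=
  (cst x : continuousType I T).

Lemma constant_path_continuous (T : topologicalType) :
  k_space T -> continuous (@constant_path_fun T).
Proof.
by move=> kT; apply: (continuous_path_curry kT (@continuous_fst _ _)).
Qed.

(* The horn [I * {0} U {0, 1} * I] is filled by reparametrization: at time [s],
   run backwards along the first side, then along [g c], then along the second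
   side, the parameter [r (1 + 2 s) - s] ranging over [[- s, 1 + s]]. *)
Lemma serre_fibration_path_ends (T : topologicalType) :
  serre_fibration R (@path_ends T).
Proof.
move=> n g H gH.
have hCI := compact_hausdorff_prod (cube_compact_hausdorff n)
  unit_interval_compact_hausdorff.
pose S := ((@cube R n * I) * I)%type.
pose w (z : S) : R := \val z.2 * (1 + 2 * \val z.1.2) - \val z.1.2.
have cw : continuous w.
  have c2 : continuous (fun z : S => \val z.2).
    exact: (continuous_o (@continuous_set_val _ _) (@continuous_snd _ _)).
  have c1 : continuous (fun z : S => \val z.1.2).
    apply: (continuous_o (@continuous_set_val _ _)).
    exact: (continuous_o (@continuous_snd _ _) (@continuous_fst _ _)).
  move=> z; apply: cvgB; last exact: c1.
  apply: cvgM; first exact: c2.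
  by apply: cvgD; [exact: cvg_cst | apply: cvgM; [exact: cvg_cst | exact: c1]].
have cc : continuous (fun z : S => z.1.1).
  exact: (continuous_o (@continuous_fst _ _) (@continuous_fst _ _)).
have cH (f : R -> R) : continuous f ->
    continuous (fun z : S => (H (z.1.1, clampI (f (w z))) : T * T)).
  move=> cf.
  have cH' : continuous (fun z => (H z : T * T)).
    apply: (@continuous_o _ _ _ (id : kification (T * T)%type -> (T * T)%type) H).
      exact: continuous_from_kification.
    by move=> x; exact: cts_fun.
  apply: (continuous_o cH').
  apply: continuous_pair => //; apply: (continuous_o continuous_clampI).
  exact: continuous_o cf cw.
(* Here [z = ((c, s), r)]. On [w <= 0] the time [- w] decreases from [s] to 0, and on [1 <= w] the
   time [w - 1] increases from 0 to [s], so the path joins the two components of [H (c, s)]. *)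
pose fH0 (z : S) : T := (H (z.1.1, clampI (- w z))).1.
pose fH1 (z : S) : T := (H (z.1.1, clampI (w z - 1))).2.
pose fg (z : S) : T := (g z.1.1 : continuousType I T) (clampI (w z)).
have cH0 : continuous fH0.
  apply: (continuous_o (@continuous_fst _ _) (cH (fun x => - x) _)).
  by move=> x; apply: cvgN.
have cH1 : continuous fH1.
  apply: (continuous_o (@continuous_snd _ _) (cH (fun x => x - 1) _)).
  by move=> x; apply: cvgB => //; exact: cvg_cst.
have cg : continuous fg.
  have cg' : continuous g by move=> x; exact: cts_fun.
  apply: (continuous_o (continuous_path_eval cg')
    (f := fun z : S => (z.1.1, clampI (w z)))).
  by apply: continuous_pair => //; exact: (continuous_o continuous_clampI).
(* This makes the three pieces agree where [w] is 0 or 1. *)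
have gH1 c : H (c, clampI 0) = path_ends T (g c) by apply: gH; exact: clamp0.
pose F (z : S) : T :=
  if w z <= 0 then fH0 z else if w z <= 1 then fg z else fH1 z.
have cF : continuous F.
  apply: continuous_if_le => //.
    apply: continuous_if_le => // z wz.
    by rewrite /fg /fH1 wz subrr gH1.
  by move=> z wz; rewrite wz ler01 /fH0 /fg wz oppr0 gH1.
have cFz (z : @cube R n * I) : continuous (fun r : I => F (z, r)).
  apply: (continuous_o cF).
  by apply: continuous_pair; [exact: cst_continuous | move=> x].
pose G (z : @cube R n * I) : path_space T :=
  (mkcts (cFz z) : continuousType I T).
have cG : continuous G.
  exact: (continuous_path_curry (compact_hausdorff_k_space hCI) cF).
have bd (r : I) : 0 <= \val r <= 1.
  by have := set_valP r; rewrite /unit_interval /= in_itv.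
have le0 (r : I) : \val r <= 0 -> r = clampI 0.
  move=> r0; rewrite -[LHS]clampIK; congr clampI.
  by apply/eqP; rewrite eq_le r0; have /andP[] := bd r.
exists (mkcts cG) => [c r r0|[c s]].
  apply/continuousEP => x; rewrite /= /mkcts /F.
  (* At homotopy time 0 the parameter is not rescaled, so [F] is [g c]; the test [w <= 0] then
     succeeds only at [x = 0], where [gH1] gives the same value. *)
  have -> : w (c, r, x) = \val x by rewrite /w /= r0; ring.
  have /andP[x0 x1] := bd x; rewrite x1.
  case: ifP => [x0'|_]; last by rewrite /fg /w /= r0 mulr0 addr0 mulr1 subr0 clampIK.
  have e : x = clampI 0 by exact: le0 x0'.
  by rewrite /fH0 e /w /= r0 clamp0 mul0r subrr oppr0 gH1.
have /andP[s0 s1] := bd s.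
rewrite /= /mkcts [RHS]surjective_pairing /path_ends_fun /=; congr pair.
  have -> : mkcts (cFz (c, s)) (clampI 0) = F (c, s, clampI 0) by [].
  have we : w (c, s, clampI 0) = - \val s by rewrite /w /= clamp0 mul0r sub0r.
  by rewrite /F we oppr_le0 s0 /fH0 we opprK clampIK.
have -> : mkcts (cFz (c, s)) (clampI 1) = F (c, s, clampI 1) by [].
have we : w (c, s, clampI 1) = 1 + \val s by rewrite /w /= clamp1; ring.
rewrite /F we leNgt (lt_le_trans ltr01) ?lerDl //=.
case: ifP => s0'; last by rewrite /fH1 we addrC addKr clampIK.
have e : s = clampI 0 by apply: le0; rewrite -(lerD2l 1) addr0.
by rewrite /fg we e /= clamp0 addr0 gH1.
Qed.

End PathSpace.

(** * Simplicial homotopies *)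

Section SimplicialHomotopy.

(** The prism identity in abstract form: [A i j] stands for face [i] of prism [j] and [B j i] for
    prism [j] of face [i]. The terms of [A] with [i < j] or [j.+1 < i] cancel against [B]; those
    with [i = j] or [i = j.+1] telescope. *)
Lemma prism_sum (V : zmodType) (m : nat) (A B : nat -> nat -> V) :
  (forall i j, (i < j <= m)%N -> A i j = B j.-1 i) ->
  (forall i j, (j.+1 < i <= m.+1)%N -> A i j = B j i.-1) ->
  (forall j, (j < m)%N -> A j.+1 j.+1 = A j.+1 j) ->
  \sum_(0 <= j < m.+1) \sum_(0 <= i < m.+2) A i j *~ (-1) ^+ (i + j) +
  \sum_(0 <= j < m) \sum_(0 <= i < m.+1) B j i *~ (-1) ^+ (i + j) =
  A 0%N 0%N - A m.+1 m.
Proof.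
move=> Alt Agt Adiag.
(* The walls between consecutive prisms, completed by the last face: row [j] contributes
   [u j - u j.+1] through its two diagonal terms. *)
pose u j := if (j <= m)%N then A j j else A m.+1 m.
have split_i j : (j < m.+1)%N ->
    \sum_(0 <= i < m.+2) A i j *~ (-1) ^+ (i + j) =
    \sum_(0 <= i < j) A i j *~ (-1) ^+ (i + j) - (u j.+1 - u j)
    - \sum_(j.+1 <= i < m.+1) B j i *~ (-1) ^+ (i + j).
  move=> jm; rewrite (@big_cat_nat _ _ _ j) //=; last by lia.
  rewrite (@big_ltn _ _ _ j m.+2); last by lia.
  rewrite (@big_ltn _ _ _ j.+1 m.+2); last by lia.
  rewrite -!addrA; congr (_ + _); rewrite opprB -!addrA.
  have -> : u j = A j j by rewrite /u -ltnS jm.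
  have -> : u j.+1 = A j.+1 j.
    rewrite /u; case: leqP => [ge|lt]; last exact: Adiag.
    by have -> : j = m by lia.
  rewrite addnn -signr_odd odd_double expr0 mulr1z; congr (_ + _).
  rewrite addSn addnn exprS -signr_odd odd_double mulr1 mulrN1z; congr (_ + _).
  rewrite big_add1 /= -sumrN; apply: eq_big_nat => i /andP[ij im].
  rewrite Agt; last by lia.
  by rewrite /= addSn exprS mulN1r mulrNz.
have -> : \sum_(0 <= j < m.+1) \sum_(0 <= i < m.+2) A i j *~ (-1) ^+ (i + j) =
    \sum_(0 <= j < m.+1) \sum_(0 <= i < j) A i j *~ (-1) ^+ (i + j)
    - \sum_(0 <= j < m.+1) (u j.+1 - u j)
    - \sum_(0 <= j < m.+1) \sum_(j.+1 <= i < m.+1) B j i *~ (-1) ^+ (i + j).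
  rewrite -!sumrB; apply: eq_big_nat => j jm; exact: split_i.
rewrite telescope_sumr //.
(* Row 0 is empty below the diagonal; shifting [j] by one turns [A i j.+1] into [B j i] and flips
   the sign. *)
have -> : \sum_(0 <= j < m.+1) \sum_(0 <= i < j) A i j *~ (-1) ^+ (i + j) =
   - \sum_(0 <= j < m) \sum_(0 <= i < j.+1) B j i *~ (-1) ^+ (i + j).
  rewrite big_nat_recl // [X in X + _]big_geq // add0r -sumrN.
  apply: eq_big_nat => j jm; rewrite -sumrN.
  apply: eq_big_nat => i im; rewrite Alt; last by lia.
  by rewrite addnS exprS mulN1r mulrNz.
have -> : \sum_(0 <= j < m.+1) \sum_(j.+1 <= i < m.+1) B j i *~ (-1) ^+ (i + j) =
   \sum_(0 <= j < m) \sum_(j.+1 <= i < m.+1) B j i *~ (-1) ^+ (i + j).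
  by rewrite big_nat_recr //= [X in _ + X]big_geq // addr0.
have -> : \sum_(0 <= j < m) \sum_(0 <= i < m.+1) B j i *~ (-1) ^+ (i + j) =
   \sum_(0 <= j < m) \sum_(0 <= i < j.+1) B j i *~ (-1) ^+ (i + j) +
   \sum_(0 <= j < m) \sum_(j.+1 <= i < m.+1) B j i *~ (-1) ^+ (i + j).
  rewrite -big_split /=; apply: eq_big_nat => j jm.
  by rewrite (@big_cat_nat _ _ _ j.+1) //=; lia.
set x := \sum_(_ <= _ < _) _; set y := \sum_(_ <= _ < _) _.
rewrite opprB [- x + _]addrC -[_ - x - y]addrA -opprD subrK.
by rewrite /u leq0n ltnn.
Qed.

Variables (N N' : augmented_faces).

(** With the shift of dimensions, [prism] at [k] acts on simplices of dimension [k], and its index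
    is meaningful up to [k]. Dimension -1 carries no prism: there the two maps must coincide. *)
Record simplicial_homotopy (a b : forall k, N k -> N' k) := SimplicialHomotopy {
  prism : forall k, nat -> N k.+1 -> N' k.+2;
  prism_states : forall x, a 0%N x = b 0%N x;
  prism_first : forall k (x : N k.+1), face ord0 (prism 0 x) = b k.+1 x;
  prism_last : forall k (x : N k.+1), face ord_max (prism k x) = a k.+1 x;
  prism_lt : forall k (i j : nat) (x : N k.+2), (i < j <= k.+1)%N ->
    face (inord i) (prism j x) = prism j.-1 (face (inord i) x);
  prism_gt : forall k (i j : nat) (x : N k.+2), (j.+1 < i <= k.+2)%N ->
    face (inord i) (prism j x) = prism j (face (inord i.-1) x);
  prism_diag : forall k (j : nat) (x : N k.+1), (j < k)%N ->
    face (inord j.+1) (prism j.+1 x) = face (inord j.+1) (prism j x)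
}.

Variables (a b : forall k, N k -> N' k).
Hypothesis a_face : forall k (i : 'I_k.+1) x, a (face i x) = face i (a x).
Hypothesis b_face : forall k (i : 'I_k.+1) x, b (face i x) = face i (b x).
Variable h : simplicial_homotopy a b.

Definition prism_chain (k : nat) :
  {additive {freeg (N k) / int} -> {freeg (N' k.+1) / int}} :=
  match k with
  | 0 => \0
  | m.+1 => free_lift (fun x => \sum_(j < m.+1) << (-1) ^+ j *g prism h j x >>)
  end.

Lemma freegUz (K : choiceType) (n : int) (x : K) :
  << n *g x >> = << x >> *~ n :> {freeg K / int}.
Proof. by rewrite freegU_mulz intz. Qed.

(** By additivity it is enough to treat a single simplex, where this is [prism_sum] with [m = k]. *)
Lemma prism_chain_homotopy (k : nat) (c : {freeg (N k.+1) / int}) :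
  boundary N' k.+1 (prism_chain k.+1 c) + prism_chain k (boundary N k c) =
  chain_map b k.+1 c - chain_map a k.+1 c.
Proof.
apply: (free_lift_ext
  (g := (boundary N' k.+1 \o prism_chain k.+1) \+ (prism_chain k \o boundary N k))
  (h := chain_map b k.+1 \- chain_map a k.+1)) => x /=.
rewrite !free_liftU !raddf_sum /=.
pose A i j : {freeg (N' k.+1) / int} := << face (inord i) (prism h j x) >>.
(* For [k = 0] the faces of [x] are states, which have no prisms: [B] is then 0, and the conditions
   relating it to [A] are vacuous. *)
pose B : nat -> nat -> {freeg (N' k.+1) / int} :=
  match k return N k.+1 -> nat -> nat -> {freeg (N' k.+1) / int} with
  | 0 => fun _ _ _ => 0
  | m.+1 => fun x j i => << prism h j (face (inord i) x) >>
  end x.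
have := @prism_sum _ k A B.
have -> : A 0%N 0%N = << b x >>.
  rewrite /A -(prism_first h); congr (<< face _ _ >>).
  by apply: val_inj; rewrite /= inordK.
have -> : A k.+1 k = << a x >>.
  rewrite /A -(prism_last h); congr (<< face _ _ >>).
  by apply: val_inj; rewrite /= inordK.
move=> <-; last 3 first.
- move=> i j ij; rewrite /A /B; case: k c x {A B} ij => [|m] c x ij; first by lia.
  by rewrite prism_lt.
- move=> i j ij; rewrite /A /B; case: k c x {A B} ij => [|m] c x ij; first by lia.
  by rewrite prism_gt.
- by move=> j jk; rewrite /A prism_diag.
congr (_ + _).
  rewrite big_mkord; apply: eq_bigr => j _.
  rewrite freegUz raddfMz /= free_liftU big_mkord mulrz_suml.
  apply: eq_bigr => i _; rewrite freegUz -mulrzA /A inord_val.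
  by rewrite exprD.
case: k c x A @B => [|m] c x A B /=.
  by rewrite big_geq //; apply: big1 => i _.
rewrite big_mkord.
under eq_bigr => i _ do
  rewrite freegUz raddfMz /= free_liftU mulrz_suml.
rewrite exchange_big /=; apply: eq_bigr => j _; rewrite big_mkord.
by apply: eq_bigr => i _; rewrite freegUz -mulrzA /B inord_val exprD mulrC.
Qed.

Lemma simplicial_homotopy_homology (k : nat) :
  augmented_homology_map a_face k =1 augmented_homology_map b_face k.
Proof.
move=> z; rewrite -[z]homology_reprK; set y := homology_repr z.
apply: esym; rewrite /augmented_homology_map /= !homology_mapE.
apply/homology_classP; exists (prism_chain k (\val y)); rewrite raddfB /=.
have := cycleP y; rewrite unfold_in /cycles; case: k z y => [|k] z y yc.
  rewrite raddf0; apply/esym/eqP; rewrite subr_eq0; apply/eqP.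
  apply: (free_lift_ext (g := chain_map b 0) (h := chain_map a 0)) => x /=.
  by rewrite !free_liftU (prism_states h).
have {}yc : boundary N k (\val y) = 0 by exact/eqP.
by rewrite -prism_chain_homotopy yc raddf0 addr0.
Qed.

End SimplicialHomotopy.

(** * Functoriality of augmented homology *)

Section HomologyFunctor.

Lemma augmented_homology_map_comp (N N' N'' : augmented_faces)
    (f : forall k, N k -> N' k) (g : forall k, N' k -> N'' k)
    (gf : forall k, N k -> N'' k)
    (f_face : forall k (i : 'I_k.+1) x, f k (face i x) = face i (f _ x))
    (g_face : forall k (i : 'I_k.+1) x, g k (face i x) = face i (g _ x))
    (gf_face : forall k (i : 'I_k.+1) x, gf k (face i x) = face i (gf _ x)) k z :
  (forall k x, gf k x = g k (f k x)) ->
  augmented_homology_map gf_face k z =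
  augmented_homology_map g_face k (augmented_homology_map f_face k z).
Proof.
move=> gfE; rewrite -[z]homology_reprK /augmented_homology_map /= !homology_mapE.
congr homology_class; apply: val_inj => /=.
apply: (free_lift_ext (g := chain_map gf k) (h := chain_map g k \o chain_map f k)).
by move=> x /=; rewrite !free_liftU gfE.
Qed.

Lemma augmented_homology_map_id (N : augmented_faces) (f : forall k, N k -> N k)
    (f_face : forall k (i : 'I_k.+1) x, f k (face i x) = face i (f _ x)) k z :
  (forall k x, f k x = x) -> augmented_homology_map f_face k z = z.
Proof.
move=> fE; rewrite -[z]homology_reprK /augmented_homology_map /= homology_mapE.
congr homology_class; apply: val_inj => /=.
apply: (free_lift_ext (g := chain_map f k) (h := idfun)).
by move=> x /=; rewrite free_liftU fE.
Qed.

(** The levelwise inverses commute with faces because the maps [f] do and are injective;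
    functoriality then gives the inverse. *)
Lemma augmented_homology_map_bij (N N' : augmented_faces)
    (f : forall k, N k -> N' k)
    (f_face : forall k (i : 'I_k.+1) x, f k (face i x) = face i (f _ x)) k :
  (forall k, bijective (f k)) -> bijective (augmented_homology_map f_face k).
Proof.
move=> fbij.
have exg j : exists g, cancel (f j) g /\ cancel g (f j).
  by have [g fK gK] := fbij j; exists g.
pose g j := sval (cid (exg j)).
have gP j : cancel (f j) (g j) /\ cancel (g j) (f j) := svalP (cid (exg j)).
have g_face j (i : 'I_j.+1) x : g j (face i x) = face i (g _ x).
  by apply: (can_inj (gP j).1); rewrite f_face !(gP _).2.
pose idf (M : augmented_faces) (j : nat) := @idfun (M j).
have idf_face (M : augmented_faces) j (i : 'I_j.+1) x :
  idf M j (face i x) = face i (idf M _ x) by [].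
exists (augmented_homology_map g_face k) => z.
  rewrite -(augmented_homology_map_comp f_face g_face (idf_face N)).
    exact: augmented_homology_map_id.
  by move=> j x; rewrite (gP j).1.
rewrite -(augmented_homology_map_comp g_face f_face (idf_face N')).
  exact: augmented_homology_map_id.
by move=> j x; rewrite (gP j).2.
Qed.

Lemma bijective_group_isomorphism (G H : zmodType) (phi : {additive G -> H}) :
  bijective phi -> group_isomorphism phi.
Proof.
move=> [psi phiK psiK].
have psiB : zmod_morphism psi.
  by move=> x y; apply: (can_inj phiK); rewrite raddfB !psiK.
pose psiA : {additive H -> G} :=
  HB.pack psi (GRing.isZmodMorphism.Build H G psi psiB).
by exists psiA.
Qed.

End HomologyFunctor.

(** * Prisms on singular simplices *)

Section PushForward.
Variable R : realType.

(** The linear map sending vertex [m] to vertex [t m]; on simplices it is the usual affine map, so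
    cofaces and degeneracies are both of this form. *)
Definition push (p q : nat) (t : 'I_p -> 'I_q) (x : 'rV[R]_p) : 'rV[R]_q :=
  \row_l \sum_(m | t m == l) x ord0 m.

(** The affine function that is 1 at the vertices in [J] and 0 at the others; it provides the time
    coordinate of a prism. *)
Definition weight (p : nat) (J : pred 'I_p) (x : 'rV[R]_p) : R :=
  \sum_(m | J m) x ord0 m.

Lemma push_id p (x : 'rV[R]_p) : push id x = x.
Proof. by apply/rowP => l; rewrite mxE big_pred1_eq. Qed.

Lemma weight_push p q (t : 'I_p -> 'I_q) (J : pred 'I_q) x :
  weight J (push t x) = weight (J \o t) x.
Proof.
rewrite /weight (partition_big t J) //=; apply: eq_bigr => l Jl.
by rewrite mxE; apply: eq_bigl => m /=; case: eqP => [->|]; rewrite ?Jl ?andbF.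
Qed.

Lemma push_comp p q s (t : 'I_p -> 'I_q) (t' : 'I_q -> 'I_s) x :
  push t' (push t x) = push (t' \o t) x.
Proof.
apply/rowP => l; rewrite [LHS]mxE [RHS]mxE.
exact: (weight_push t [pred m | t' m == l] x).
Qed.

Lemma insert_zero_push n (i : 'I_n.+2) (x : 'rV[R]_n.+1) :
  insert_zero i x = push (fintype.lift i) x.
Proof.
apply/rowP => l; rewrite !mxE; case: unliftP => [m ->|->] /=.
  by rewrite (eq_bigl (pred1 m)) ?big_pred1_eq // => m' /=; rewrite (inj_eq lift_inj).
by rewrite big_pred0 // => m; rewrite eq_sym (negbTE (neq_lift _ _)).
Qed.

Lemma push_simplex p q (t : 'I_p.+1 -> 'I_q.+1) (x : @simplex R p) :
  push t (\val x) \in @simplex R q.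
Proof.
have [x0 x1] := set_valP x; apply/mem_set; split=> [l|].
  by rewrite mxE; apply: sumr_ge0 => m _.
by have := weight_push t predT (\val x); rewrite /weight /= => ->.
Qed.

Lemma weight_unit_interval p (J : pred 'I_p.+1) (x : @simplex R p) :
  weight J (\val x) \in @unit_interval R.
Proof.
have [x0 x1] := set_valP x; apply/mem_set.
rewrite /unit_interval /= in_itv /= sumr_ge0 //= -x1 /weight [leLHS]big_mkcond.
by apply: ler_sum => m _; case: (J m).
Qed.

Definition push_map p q (t : 'I_p.+1 -> 'I_q.+1) (x : @simplex R p) :
  @simplex R q := exist _ (push t (\val x)) (push_simplex t x).

Definition weight_map p (J : pred 'I_p.+1) (x : @simplex R p) :
  @unit_interval R := exist _ (weight J (\val x)) (weight_unit_interval J x).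

Lemma weight_continuous p (J : pred 'I_p.+1) :
  continuous (fun x : @simplex R p => weight J (\val x)).
Proof.
apply: continuous_big => [|m _]; first exact: add_continuous.
apply: (continuous_o (g := fun y : 'rV[R]_p.+1 => y ord0 m)).
  exact: coord_continuous.
exact: continuous_set_val.
Qed.

Lemma weight_map_continuous p (J : pred 'I_p.+1) : continuous (weight_map J).
Proof. by apply: continuous_into_set; exact: weight_continuous. Qed.

Lemma push_map_continuous p q (t : 'I_p.+1 -> 'I_q.+1) :
  continuous (push_map t).
Proof.
apply: continuous_into_set => x A [P hP sPA].
have h l : \forall y \near x, P ord0 l (push t (\val y) ord0 l).
  have cl : continuous (fun y : @simplex R p => push t (\val y) ord0 l).
    rewrite (_ : (fun y => _) = fun y : @simplex R p =>
      weight [pred m | t m == l] (\val y)); first exact: weight_continuous.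
    by apply/funext => y; rewrite mxE.
  exact: (cl x _ (hP ord0 l)).
have {}h : \forall y \near x, forall l, P ord0 l (push t (\val y) ord0 l).
  exact: filter_forall h.
by apply: filterS h => y hy; apply: sPA => i l; rewrite ord1; exact: hy.
Qed.

End PushForward.

Section SingularPrism.
Variables (R : realType) (T U : topologicalType).
Variable psi : continuousType T (path_space R U).

(** The affine simplex of the prism over the [n]-simplex whose vertex [m] lies over [t m], at time 1
    if [J m] and at time 0 otherwise, followed by the homotopy [psi] along [sigma]. Face identities
    thus reduce to identities between [t] and [J]. *)
Definition sweep_fun (p n : nat) (t : 'I_p.+1 -> 'I_n.+1) (J : pred 'I_p.+1)
    (sigma : singular_simplices R T n) (x : @simplex R p) : U :=
  (psi (sigma (push_map t x)) : continuousType (@unit_interval R) U)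
    (weight_map J x).

Lemma sweep_continuous p n (t : 'I_p.+1 -> 'I_n.+1) J sigma :
  continuous (sweep_fun t J sigma).
Proof.
have c : continuous (psi \o sigma) by move=> x; exact: cts_fun.
apply: (continuous_o (continuous_path_eval c)
  (f := fun x => (push_map t x, weight_map J x))).
by apply: continuous_pair;
  [exact: push_map_continuous | exact: weight_map_continuous].
Qed.

Definition sweep p n (t : 'I_p.+1 -> 'I_n.+1) (J : pred 'I_p.+1)
    (sigma : singular_simplices R T n) : singular_simplices R U p :=
  mkcts (@sweep_continuous p n t J sigma).

Lemma eq_sweep p n (t t' : 'I_p.+1 -> 'I_n.+1) J J' sigma :
  t =1 t' -> J =1 J' -> sweep t J sigma = sweep t' J' sigma.
Proof.
move=> /funext -> /funext JJ; apply/continuousEP => x.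
by rewrite JJ.
Qed.

Lemma face_sweep p n (t : 'I_p.+2 -> 'I_n.+1) J sigma (i : 'I_p.+2) :
  singular_face i (sweep t J sigma) =
  sweep (t \o fintype.lift i) (J \o fintype.lift i) sigma.
Proof.
apply/continuousEP => x; rewrite /= /mkcts /sweep_fun; congr (psi (sigma _) _).
  by apply: val_inj; rewrite /= insert_zero_push push_comp.
by apply: val_inj; rewrite /= insert_zero_push weight_push.
Qed.

Lemma sweep_face p n (t : 'I_p.+1 -> 'I_n.+1) J sigma (i : 'I_n.+2) :
  sweep t J (singular_face i sigma) = sweep (fintype.lift i \o t) J sigma.
Proof.
apply/continuousEP => x; rewrite /= /mkcts /sweep_fun /=.
congr (psi (sigma _) _); apply: val_inj.
by rewrite /= insert_zero_push push_comp.
Qed.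

Lemma sweep_start n (sigma : singular_simplices R T n) x :
  sweep id pred0 sigma x =
  (psi (sigma x) : continuousType (@unit_interval R) U) (clampI 0).
Proof.
rewrite /= /mkcts /sweep_fun; congr (psi (sigma _) _); apply: val_inj => /=.
  exact: push_id.
by rewrite /weight big_pred0_eq clamp0.
Qed.

Lemma sweep_end n (sigma : singular_simplices R T n) x :
  sweep id predT sigma x =
  (psi (sigma x) : continuousType (@unit_interval R) U) (clampI 1).
Proof.
rewrite /= /mkcts /sweep_fun; congr (psi (sigma _) _); apply: val_inj => /=.
  exact: push_id.
rewrite /weight clamp1.
by have [] := set_valP x.
Qed.

Definition degeneracy (p j : nat) (m : 'I_p.+2) : 'I_p.+1 := inord (unbump j m).

(** The standard triangulation: for [j <= p] the vertices are (0,0), ..., (j,0), (j,1), ...,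
    (p,1). *)
Definition singular_prism (p j : nat) (sigma : singular_simplices R T p) :
  singular_simplices R U p.+1 :=
  sweep (@degeneracy p j) (fun m => (j < m)%N) sigma.

Lemma degeneracyE p j (m : 'I_p.+2) :
  (j <= p)%N -> degeneracy j m = (m - (j < m))%N :> nat.
Proof.
move=> jp; rewrite /degeneracy inordK // /unbump.
by have := ltn_ord m; lia.
Qed.

Lemma val_lift n (i : 'I_n.+1) (m : 'I_n) :
  fintype.lift i m = ((i <= m) + m)%N :> nat.
Proof. by []. Qed.

Lemma singular_prism_first p (sigma : singular_simplices R T p) x :
  singular_face ord0 (singular_prism 0 sigma) x =
  (psi (sigma x) : continuousType (@unit_interval R) U) (clampI 1).
Proof.
rewrite -sweep_end /singular_prism face_sweep; congr (Continuous.sort _ x).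
apply: eq_sweep => m //=; apply: val_inj.
by rewrite /= degeneracyE // val_lift /=; lia.
Qed.

Lemma singular_prism_last p (sigma : singular_simplices R T p) x :
  singular_face ord_max (singular_prism p sigma) x =
  (psi (sigma x) : continuousType (@unit_interval R) U) (clampI 0).
Proof.
rewrite -sweep_start /singular_prism face_sweep; congr (Continuous.sort _ x).
apply: eq_sweep => m; last by rewrite /= ?val_lift /bump /=; have := ltn_ord m; lia.
apply: val_inj; rewrite /= degeneracyE // ?val_lift /bump /=.
by have := ltn_ord m; lia.
Qed.

Lemma singular_prism_lt p (i j : nat) (sigma : singular_simplices R T p.+1) :
  (i < j <= p.+1)%N ->
  singular_face (inord i) (singular_prism j sigma) =
  singular_prism j.-1 (singular_face (inord i) sigma).
Proof.
move=> ij; rewrite /singular_prism face_sweep sweep_face.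
apply: eq_sweep => m /=; last by rewrite ?val_lift /bump inordK; lia.
apply: val_inj; rewrite /= degeneracyE; last by lia.
rewrite ?val_lift /bump degeneracyE; last by lia.
by rewrite !inordK; lia.
Qed.

Lemma singular_prism_gt p (i j : nat) (sigma : singular_simplices R T p.+1) :
  (j.+1 < i <= p.+2)%N ->
  singular_face (inord i) (singular_prism j sigma) =
  singular_prism j (singular_face (inord i.-1) sigma).
Proof.
move=> ij; rewrite /singular_prism face_sweep sweep_face.
apply: eq_sweep => m /=; last by rewrite ?val_lift /bump inordK; lia.
apply: val_inj; rewrite /= degeneracyE; last by lia.
rewrite ?val_lift /bump degeneracyE; last by lia.
by rewrite !inordK; lia.
Qed.

(** One side drops the vertex (j+1,0), the other (j,1); both leave (0,0), ..., (j,0), (j+1,1), ...,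
    (p,1). *)
Lemma singular_prism_diag p (j : nat) (sigma : singular_simplices R T p) :
  (j < p)%N ->
  singular_face (inord j.+1) (singular_prism j.+1 sigma) =
  singular_face (inord j.+1) (singular_prism j sigma).
Proof.
move=> jp; rewrite /singular_prism !face_sweep.
apply: eq_sweep => m /=; last by rewrite ?val_lift /bump inordK; lia.
apply: val_inj; rewrite /= !degeneracyE; [|by lia|by lia].
by rewrite ?val_lift /bump !inordK; lia.
Qed.

End SingularPrism.

(** * Homology of the merging space of a flow *)

Section FlowNerve.
Variables (R : realType) (M : forall X : flow, merging_space X).

(** The analogue of [merging_nerve] without cofibrant replacement. It is functorial in all flows,
    including those produced by factorizations. *)
Definition flow_nerve (X : flow) : augmented_faces :=
  @AugmentedFaces
    (fun k => match k with
              | 0 => states X : choiceType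
              | n.+1 => singular_simplices R (M X) n
              end)
    (fun k => match k with
              | 0 => fun _ gamma =>
                  merging_tgt (M X) (flow_id X) (gamma (simplex_point R))
              | n.+1 => fun i sigma => singular_face i sigma
              end).

Definition flow_nerve_map (X Y : flow) (f : flow_hom X Y) (k : nat) :
  flow_nerve X k -> flow_nerve Y k :=
  match k with
  | 0 => hom_states f
  | n.+1 => fun sigma => merging_map (M X) (M Y) f \o sigma
  end.

Lemma merging_mapE (X Y : flow) (f : flow_hom X Y) x :
  merging_map (M X) (M Y) f (mg_proj (M X) x) = mg_proj (M Y) (hom_path f x).
Proof. exact: merging_liftE. Qed.

Lemma merging_tgtE (X Y : flow) (f : flow_hom X Y) x :
  merging_tgt (M X) f (mg_proj (M X) x) = tgt (hom_path f x).
Proof. exact: merging_liftE. Qed.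

Lemma merging_ext1 (X : flow) (T : topologicalType)
    (psi psi' : continuousType (M X) T) :
  compactly_generated T ->
  (forall x, psi (mg_proj (M X) x) = psi' (mg_proj (M X) x)) -> psi =1 psi'.
Proof. by move=> cgT e; apply/continuousEP; exact: merging_ext. Qed.

Lemma merging_map_tgt (X Y : flow) (f : flow_hom X Y) z :
  merging_tgt (M Y) (flow_id Y) (merging_map (M X) (M Y) f z) =
  hom_states f (merging_tgt (M X) (flow_id X) z).
Proof.
have cf : continuous (hom_states f).
  by apply/continuousP => A _; exact: discrete_open.
apply: (@merging_ext1 X _
  (merging_tgt (M Y) (flow_id Y) \o merging_map (M X) (M Y) f)
  (mkcts cf \o merging_tgt (M X) (flow_id X))) => [|x].
  exact: (@discrete_compactly_generated (states Y)).
rewrite /= merging_mapE /mkcts !merging_tgtE /=; exact: hom_tgt.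
Qed.

Lemma flow_nerve_map_face (X Y : flow) (f : flow_hom X Y) k
    (i : 'I_k.+1) (x : flow_nerve X k.+1) :
  flow_nerve_map f (face i x) = face i (flow_nerve_map f x).
Proof.
case: k i x => [|n] i x /=; first by rewrite merging_map_tgt.
by apply/continuousEP.
Qed.

Definition flow_homology_map (X Y : flow) (f : flow_hom X Y) (k : nat) :=
  augmented_homology_map (@flow_nerve_map_face X Y f) k.

Lemma flow_homology_map_comp (X Y Z : flow) (g : flow_hom Y Z)
    (f : flow_hom X Y) k z :
  flow_homology_map (flow_comp g f) k z =
  flow_homology_map g k (flow_homology_map f k z).
Proof.
apply: augmented_homology_map_comp => -[|n] x //=.
apply/continuousEP => s /=.
apply: (@merging_ext1 X _ (merging_map (M X) (M Z) (flow_comp g f))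
  (merging_map (M Y) (M Z) g \o merging_map (M X) (M Y) f)) => [|y].
  exact: mg_cg.
by rewrite /= !merging_mapE.
Qed.

Lemma flow_homology_map_id (X : flow) k z : flow_homology_map (flow_id X) k z = z.
Proof.
apply: augmented_homology_map_id => -[|n] x //=.
apply/continuousEP => s /=.
apply: (@merging_ext1 X _ (merging_map (M X) (M X) (flow_id X)) idfun) => [|y].
  exact: mg_cg.
by rewrite /= !merging_mapE.
Qed.

(** The map [psi] is a homotopy in adjoint form, and its singular prisms form a simplicial homotopy;
    equality on states is the condition in dimension -1. *)
Lemma flow_homology_map_homotopy (X Y : flow) (a b : flow_hom X Y)
    (psi : continuousType (M X) (path_space R (M Y))) k :
  hom_states a =1 hom_states b ->
  (forall z, (psi z : continuousType (@unit_interval R) (M Y)) (clampI 0) =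
             merging_map (M X) (M Y) a z) ->
  (forall z, (psi z : continuousType (@unit_interval R) (M Y)) (clampI 1) =
             merging_map (M X) (M Y) b z) ->
  flow_homology_map a k =1 flow_homology_map b k.
Proof.
move=> ab pa pb; apply: simplicial_homotopy_homology.
pose P n (j : nat) (sigma : flow_nerve X n.+1) : flow_nerve Y n.+2 :=
  singular_prism psi j sigma.
refine (@SimplicialHomotopy _ _ _ _ P ab _ _ _ _ _) => n.
- by move=> s; apply/continuousEP => x; rewrite [LHS]singular_prism_first pb.
- by move=> s; apply/continuousEP => x; rewrite [LHS]singular_prism_last pa.
- by move=> i j s; exact: singular_prism_lt.
- by move=> i j s; exact: singular_prism_gt.
- by move=> j s; exact: singular_prism_diag.
Qed.

End FlowNerve.

(** * Lifting arguments in the category of flows *)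

Section Flows.

Lemma flow_hom_ext (X Y : flow) (f g : flow_hom X Y) :
  hom_states f =1 hom_states g -> hom_path f =1 hom_path g -> f = g.
Proof.
case: f g => [fs fp hs ht hc] [gs gp hs' ht' hc'] /= /funext es /continuousEP ep.
by move: es ep => es ep; subst; congr FlowHom; exact: Prop_irrelevance.
Qed.

Lemma flow_id_comp (X Y : flow) (f : flow_hom X Y) : flow_comp (flow_id Y) f = f.
Proof. exact: flow_hom_ext. Qed.

Let point : discreteTopologicalType := discrete_topology unit.

Lemma point_unique (a b : point) : a = b.
Proof. by move: a b => -[] []. Qed.

Lemma merging_flow_comp_continuous (T : topologicalType) :
  continuous ((fun p => (\val p).2) :
    kification (composable (cst tt : T -> point) (cst tt : T -> point)) -> T).
Proof.
set C := composable _ _.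
apply: (@continuous_o _ _ _ (fun p : C => (\val p).2) (id : kification C -> C)).
  exact: (continuous_o (@continuous_snd _ _) (@continuous_set_val _ _)).
exact: continuous_from_kification.
Qed.

(* The right adjoint of [X |-> P^+ X]: with [x * y = y], flow morphisms into it
   are exactly the merging invariant maps to [T]. *)
Definition merging_flow (T : topologicalType) (cgT : compactly_generated T) : flow.
Proof.
by refine (@Flow point T cgT (cst tt) (cst tt) (fun _ y _ => y)
  (@merging_flow_comp_continuous T) _ _ _).
Defined.

Definition to_merging_flow (X : flow) (T : topologicalType)
    (cgT : compactly_generated T) (phi : continuousType (Defs.path X) T)
    (inv : merging_invariant phi) : flow_hom X (merging_flow cgT).
Proof.
refine (@FlowHom X (merging_flow cgT) (cst tt) phi _ _ _) => // x y h h'.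
by rewrite -(inv _ _ h).
Defined.

Definition merging_flow_map (T U : topologicalType)
    (cgT : compactly_generated T) (cgU : compactly_generated U)
    (phi : continuousType T U) :
  flow_hom (merging_flow cgT) (merging_flow cgU).
Proof.
by refine (@FlowHom (merging_flow cgT) (merging_flow cgU) idfun phi _ _ _).
Defined.

Lemma merging_flow_invariant (X : flow) (T : topologicalType)
    (cgT : compactly_generated T) (f : flow_hom X (merging_flow cgT)) :
  merging_invariant (hom_path f).
Proof.
move=> x y h.
by rewrite (@hom_comp _ _ f x y h).
Qed.

(** The terminal flow. *)
Definition point_flow : flow := merging_flow (@discrete_compactly_generated point).

Lemma merging_invariant_cst (X : flow) :
  merging_invariant (cst tt : continuousType (Defs.path X) point).
Proof. by []. Qed.

Definition to_point (X : flow) : flow_hom X point_flow :=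
  to_merging_flow (@discrete_compactly_generated point) (@merging_invariant_cst X).

Lemma to_point_unique (X : flow) (f g : flow_hom X point_flow) : f = g.
Proof.
by apply: flow_hom_ext => x; exact: point_unique.
Qed.

Lemma from_empty_unique (X : flow) (f g : flow_hom empty_flow X) : f = g.
Proof. by apply: flow_hom_ext => -[]. Qed.

(** Every flow is fibrant: a lift constant in time lies over any homotopy in a point. *)
Lemma flow_fibration_to_point (R : realType) (X : flow) :
  flow_fibration R (to_point X).
Proof.
move=> n g H _.
have cG : continuous (fun z : @cube R n * @unit_interval R => g z.1).
  by apply: (continuous_o (g := g)); [move=> x; exact: cts_fun|exact: continuous_fst].
by exists (mkcts cG) => // z; exact: point_unique.
Qed.

End Flows.

(** * Trivial cofibrations, then weak equivalences of cofibrant flows *)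

Section TrivialCofibration.
Variables (R : realType) (Cof : flow_class).
Let W := weak_S_homotopy_equivalence R.
Let Fib := flow_fibration R.
Hypothesis model : model_structure W Cof Fib.
Variable M : forall X : flow, merging_space X.

Lemma flow_homology_trivial_cofibration (A B : flow) (j : flow_hom A B) k :
  Cof j -> W j -> bijective (flow_homology_map R M j k).
Proof.
move=> cj wj.
have [|r rj _] := model_lift_fib model cj wj (@flow_fibration_to_point R A)
  (u := flow_id A) (v := to_point B); first exact: to_point_unique.
pose T := M B; have cgT : compactly_generated T := mg_cg T.
have cgP := compactly_generated_path_space R cgT.1.
have cgTT := compactly_generated_prod R cgT.1.
pose p := merging_flow_map cgP cgTT (path_ends R T).
have kc : continuous (@constant_path_fun R T) := constant_path_continuous cgT.2.
pose eta : continuousType (Defs.path B) T := mg_proj T.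
(* The lifting square: [A] maps to the constant paths at the classes of [j x], and [B] to the pairs
   of classes of [j (r x)] and [x]. It commutes because [r j = 1]. *)
pose uf : continuousType (Defs.path A) (path_space R T) :=
  mkcts kc \o (eta \o hom_path j).
have uinv : merging_invariant uf.
  move=> x y h; rewrite /uf /=.
  have h' : tgt (hom_path j x) = src (hom_path j y) by rewrite hom_tgt h hom_src.
  by rewrite (hom_comp h h') /eta (mg_invariant T h').
have vc : continuous
    (fun x => (eta (hom_path j (hom_path r x)), eta x) : kification (T * T)%type).
  apply: continuous_into_kification; first by case: (path_cg B).
  apply: continuous_pair => x; last exact: cts_fun.
  exact: (@cts_fun _ _ (eta \o hom_path j \o hom_path r)).
have vinv : merging_invariant (mkcts vc).
  move=> x y h; rewrite /mkcts.
  have h1 : tgt (hom_path r x) = src (hom_path r y) by rewrite hom_tgt h hom_src.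
  have h2 : tgt (hom_path j (hom_path r x)) = src (hom_path j (hom_path r y)).
    by rewrite !hom_tgt h !hom_src.
  by rewrite (hom_comp h h1) (hom_comp h1 h2) /eta -(mg_invariant T h)
    -(mg_invariant T h2).
have rjE x : hom_path r (hom_path j x) = x.
  by have /(congr1 (fun f => hom_path f x)) := rj.
have [|l _ pl] := model_lift_fib model cj wj
    (@serre_fibration_path_ends R T : Fib p)
    (u := to_merging_flow cgP uinv) (v := to_merging_flow cgTT vinv).
  apply: flow_hom_ext => x //=.
  by rewrite /uf /= /mkcts rjE.
have linv := merging_flow_invariant l.
(* By adjunction the lift [l] becomes a homotopy on the merging space of [B], from the map induced
   by [j r] to the identity. *)
pose psi : continuousType T (path_space R T) := merging_lift T cgP linv.
have psiE x : psi (mg_proj T x) = hom_path l x by exact: merging_liftE.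
have lE x : path_ends R T (hom_path l x) =
    (eta (hom_path j (hom_path r x)), eta x).
  by have /(congr1 (fun f => hom_path f x)) := pl.
have cev (i : @unit_interval R) : continuous (fun z =>
    (psi z : continuousType (@unit_interval R) T) i).
  by apply: continuous_path_at => x; exact: cts_fun.
(* On states [j] is bijective, so its left inverse [r] is also a right inverse. *)
have statesE : hom_states (flow_comp j r) =1 hom_states (flow_id B).
  move=> b /=; have [g _ gK] := wj.1.
  have /(congr1 (fun f => hom_states f (g b))) /= := rj.
  by rewrite gK => ->.
have jr z : flow_homology_map R M (flow_comp j r) k z = z.
  rewrite -[RHS](flow_homology_map_id z).
  apply: (flow_homology_map_homotopy (psi := psi)) => // {}z.
    apply: (@merging_ext1 M B _ (mkcts (cev (clampI 0))) _ cgT) => x.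
    rewrite /= /mkcts psiE merging_mapE /=.
    by have /(congr1 fst) := lE x.
  apply: (@merging_ext1 M B _ (mkcts (cev (clampI 1))) _ cgT) => x.
  rewrite /= /mkcts psiE merging_mapE /=.
  by have /(congr1 snd) := lE x.
exists (flow_homology_map R M r k) => z; rewrite -flow_homology_map_comp //.
by rewrite rj flow_homology_map_id.
Qed.

Lemma flow_homology_weak_equivalence (A B : flow) (f : flow_hom A B) k :
  Cof (from_empty A) -> Cof (from_empty B) -> W f ->
  bijective (flow_homology_map R M f k).
Proof.
move=> cA cB wf.
have [Z [i [p [fE ci wi fibp]]]] := model_factor_fib model f.
have wp : W p.
  have [_ h _] := model_2of3 model i p; apply: h => //; by rewrite -fE.
have [|s _ ps] := model_lift_cof model cB fibp wp
  (u := from_empty Z) (v := flow_id B); first exact: from_empty_unique.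
have ws : W s.
  have [_ _ h] := model_2of3 model s p; apply: h => //.
  (* The identity is a weak equivalence by two-out-of-three, since composing it with [p] gives
     [p]. *)
  rewrite ps; have [_ h' _] := model_2of3 model p (flow_id B).
  by apply: h' => //; rewrite flow_id_comp.
have [V [j [q [sE cj wj fibq]]]] := model_factor_fib model s.
have wq : W q.
  have [_ h _] := model_2of3 model j q; apply: h => //; by rewrite -sE.
(* The section [u] of [q] comes from two lifts: [i] lifts through [q] since [A] is cofibrant, and
   the lift [a] then extends along the cofibration [i]. *)
have [|a _ qa] := model_lift_cof model cA fibq wq
  (u := from_empty V) (v := i); first exact: from_empty_unique.
have [|u _ qu] := model_lift_cof model ci fibq wq (u := a) (v := flow_id Z).
  by rewrite qa flow_id_comp.
have Hi := flow_homology_trivial_cofibration k ci wi.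
have [Hj' HjK HjK'] := flow_homology_trivial_cofibration k cj wj.
have Hps z : flow_homology_map R M p k (flow_homology_map R M s k z) = z.
  by rewrite -flow_homology_map_comp ps flow_homology_map_id.
have Hqu z : flow_homology_map R M q k (flow_homology_map R M u k z) = z.
  by rewrite -flow_homology_map_comp qu flow_homology_map_id.
have Hs z : flow_homology_map R M s k (flow_homology_map R M p k z) = z.
  (* In homology [s] is [q j], [j] is invertible and [q u = 1], so every class is in the image of
     [s]; there [s p] is the identity because [p s = 1]. *)
  have -> : z = flow_homology_map R M s k (Hj' (flow_homology_map R M u k z)).
    by rewrite sE flow_homology_map_comp HjK' Hqu.
  by rewrite Hps.
have Hp : bijective (flow_homology_map R M p k).
  by exists (flow_homology_map R M s k).
apply: eq_bij (bij_comp Hp Hi) _ _ => z /=.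
by rewrite fE flow_homology_map_comp.
Qed.

End TrivialCofibration.

(** * Comparison of the nerve of the replacement with the merging nerve *)

Section Comparison.
Variables (R : realType) (W Cof Fib : flow_class).
Variables (Q : cofibrant_replacement W Cof Fib).
Variable M : forall X : flow, merging_space X.

(** The two nerves have the same singular simplices and differ only in dimension -1, where the
    states of [Q X] are sent to those of [X]. *)
Definition nerve_comparison (X : flow) (k : nat) :
  flow_nerve R M (Q X) k -> merging_nerve R Q M X k :=
  match k with
  | 0 => hom_states (cr_proj Q X)
  | n.+1 => idfun
  end.

Lemma nerve_comparison_face (X : flow) k (i : 'I_k.+1)
    (x : flow_nerve R M (Q X) k.+1) :
  nerve_comparison (face i x) = face i (nerve_comparison x).
Proof.
case: k i x => [|n] i x //=; move: (x _) => z.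
have cf : continuous (hom_states (cr_proj Q X)).
  by apply/continuousP => A _; exact: discrete_open.
apply: (@merging_ext1 M (Q X) _
  (mkcts cf \o merging_tgt (M (Q X)) (flow_id (Q X)))
  (ho_merging_tgt Q M X)) => [|y].
  exact: (@discrete_compactly_generated (states X)).
rewrite /= /mkcts /ho_merging_tgt !merging_tgtE /=; exact/esym/hom_tgt.
Qed.

Lemma merging_homology_comparison (X Y : flow) (f : flow_hom X Y) k z :
  merging_homology_map R Q M k f
    (augmented_homology_map (@nerve_comparison_face X) k z) =
  augmented_homology_map (@nerve_comparison_face Y) k
    (flow_homology_map R M (cr_map Q f) k z).
Proof.
(* The diagonal of the naturality square; both composites induce the same map as [g], by
   [cr_natural] in dimension -1. *)
pose g k x := nerve_comparison (X := Y) (k := k) (flow_nerve_map (cr_map Q f) x).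
have g_face n (i : 'I_n.+1) x : g n (face i x) = face i (g _ x).
  by rewrite /g flow_nerve_map_face nerve_comparison_face.
apply: etrans (augmented_homology_map_comp _ (@nerve_comparison_face Y) g_face z _) => //.
apply: esym; apply: augmented_homology_map_comp => -[|n] x //=.
by have /(congr1 (fun h => hom_states h x)) := cr_natural Q f.
Qed.

End Comparison.

Theorem corollaryA11 (R : realType) (Cof : flow_class)
    (model : model_structure (weak_S_homotopy_equivalence R) Cof
                             (flow_fibration R))
    (Q : cofibrant_replacement (weak_S_homotopy_equivalence R) Cof
                               (flow_fibration R))
    (M : forall Z : flow, merging_space Z)
    (X Y : flow) (f : flow_hom X Y)
    (hf : weak_S_homotopy_equivalence R f) (n : nat) :
  group_isomorphism (merging_homology_map R Q M n f).
Proof.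
apply: bijective_group_isomorphism.
(* Two-out-of-three in the naturality square of the projections to [X] and [Y]. *)
have wQf : weak_S_homotopy_equivalence R (cr_map Q f).
  have [_ _ h] := model_2of3 model (cr_map Q f) (cr_proj Q Y).
  apply: h; first exact: cr_weq.
  rewrite cr_natural; have [h _ _] := model_2of3 model (cr_proj Q X) f.
  by apply: h => //; exact: cr_weq.
have bQ := flow_homology_weak_equivalence model M n (cr_cofibrant Q X)
  (cr_cofibrant Q Y) wQf.
have bc Z : bijective (augmented_homology_map
    (@nerve_comparison_face R _ _ _ Q M Z) n).
  apply: augmented_homology_map_bij => -[|k]; first exact: (cr_weq Q Z).1.
  by exists idfun.
(* The map induced by [f] is that of [Q f], conjugated by the two comparison isomorphisms. *)
have [c cK Kc] := bc X.
apply: eq_bij (bij_comp (bc Y) (bij_comp bQ (Bijective Kc cK))) _ _ => z /=.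
by rewrite -merging_homology_comparison Kc.
Qed.
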